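(* Let $G$ be a Polish groupoid such that every orbit of $G$ that is a $G_\delta$ subset of $G^0$ is also $F_\sigma$. The following are equivalent: (1) there is an orbit which is not $G_\delta$; (2) $E_0\sqsubseteq_c G$; (3) $E_0$ is Borel reducible to $E_G$; (4) there is an $E_G$-nonatomic $E_G$-ergodic Borel probability measure on $G^0$; (5) $E_G$ is not smooth; (6) $E_G$ is not a $G_\delta$ subset of $G^0\times G^0$; (7) some orbit is not open in its closure.
   Context: A groupoid is a small category in which every arrow is invertible; $G^0$ objects (identified with identity arrows), $s,r$ source and range, $xGy=\{\gamma:r(\gamma)=x,s(\gamma)=y\}$. A topological space is locally Polish if it has a countable basis of open sets Polish in the relative topology. A Polish groupoid is a groupoid with a locally Polish topology such that composition and inversion are continuous and open, $G^0$ is Polish, and $s^{-1}(x)$, $r^{-1}(x)$ are Polish for all $x\in G^0$. $E_G$ on $G^0$: $xE_Gy$ iff $yGx\neq\varnothing$; orbits are $E_G$-classes. $E_0$ is the equivalence relation on $2^\omega$: $xE_0y$ iff $x(n)=y(n)$ for all but finitely many $n$; as a Polish groupoid it has arrows $(y,x)$ from $x$ to $y$, $(z,y)(y,x)=(z,x)$, and the topology making $(g,x)\mapsto(g+x,x)$ from $(\bigoplus_n\mathbb{Z}/2\mathbb{Z})\times2^\omega$ (discrete times product topology) onto $E_0$ a homeomorphism. $E_0\sqsubseteq_c G$ means there is an injective continuous functor $F:E_0\to G$ with $xE_0y$ iff $F(y)GF(x)\neq\varnothing$. An equivalence relation is smooth if it is Borel reducible to equality on a Polish space. A Borel probability measure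 $\mu$ is $E$-ergodic if every $E$-invariant Borel set has measure $0$ or $1$, and $E$-nonatomic if every $E$-class has measure $0$. *)

(* Defs.v *)
From HB Require Import structures.
From mathcomp Require Import all_boot all_order all_algebra.
From mathcomp Require Import all_classical all_reals all_analysis.
From mathcomp Require Import borel_hierarchy.

Set Implicit Arguments.
Unset Strict Implicit.
Unset Printing Implicit Defensive.

Local Open Scope classical_set_scope.

Definition open_map (S T : topologicalType) (f : S -> T) :=
  forall U, open U -> open (f @` U).

Definition homeomorphism (S T : topologicalType) (f : S -> T) :=
  [/\ bijective f, continuous f & open_map f].

(* The topology of S is the relative topology of the image of f. *)
Definition embedding (S T : topologicalType) (f : S -> T) :=
  injective f /\
  forall U : set S, open U <-> exists2 V, open V & U = f @^-1` V.

(* Completeness is the axiom of the library's completeType, which is restricted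
   to pointed types and therefore not used directly: the empty space is Polish. *)
Definition polish (R : realType) (T : topologicalType) :=
  (exists2 D : set T, countable D & dense D) /\
  exists (M : metricType R) (f : T -> M), homeomorphism f /\
    forall F : set_system M, ProperFilter F -> cauchy F -> exists l : M, F --> l.

(* A set coerces to its subtype, which carries the relative topology. *)
Definition locally_polish (R : realType) (T : topologicalType) :=
  exists B : set (set T),
    [/\ countable B, basis B & forall U, B U -> polish R U].

Definition open_in_closure (T : topologicalType) (A : set T) :=
  exists2 U, open U & A = U `&` closure A.

Definition borel (T : topologicalType) : set (set T) := <<s @open T >>.

Definition borel_fun (S T : topologicalType) (f : S -> T) :=
  forall B, borel B -> borel (f @^-1` B).

Definition borel_reducible (S T : topologicalType)
    (E : S -> S -> Prop) (F : T -> T -> Prop) :=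
  exists2 f : S -> T, borel_fun f & forall x y, E x y <-> F (f x) (f y).

Definition smooth (R : realType) (S : topologicalType) (E : S -> S -> Prop) :=
  exists2 Y : topologicalType,
    polish R Y & borel_reducible E (fun y z : Y => y = z).

(* Measurable types are pointed in the library.  The point x0 below only
   witnesses that T is inhabited; the measurable sets do not depend on it. *)
Definition pointed_at (T : topologicalType) (x0 : T) : Type := T.

HB.instance Definition _ (T : topologicalType) (x0 : T) :=
  Choice.copy (pointed_at x0) T.
HB.instance Definition _ (T : topologicalType) (x0 : T) :=
  isPointed.Build (pointed_at x0) x0.

Notation borel_space x0 :=
  (g_sigma_algebraType (@open _ : set (set (pointed_at x0)))).

Definition ergodic (R : realType) (T : topologicalType) (x0 : T)
    (E : T -> T -> Prop) (mu : probability (borel_space x0) R) :=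
  forall A : set T, borel A -> (forall x y, E x y -> A x -> A y) ->
    mu A = 0%E \/ mu A = 1%E.

(* The value of mu is meaningful on Borel sets only, so "of measure 0" is
   rendered as "contained in a Borel set of measure 0"; the two notions agree
   on classes that are Borel. *)
Definition nonatomic (R : realType) (T : topologicalType) (x0 : T)
    (E : T -> T -> Prop) (mu : probability (borel_space x0) R) :=
  forall x, mu.-negligible [set y | E x y].

(* gcomp g h is the arrow gh; its value is irrelevant unless src g = rng h. *)
Record groupoid (Obj Arr : Type) := Groupoid {
  src : Arr -> Obj;
  rng : Arr -> Obj;
  idn : Obj -> Arr;
  gcomp : Arr -> Arr -> Arr;
  ginv : Arr -> Arr;
  src_idn : forall x, src (idn x) = x;
  rng_idn : forall x, rng (idn x) = x;
  src_comp : forall g h, src g = rng h -> src (gcomp g h) = src h;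
  rng_comp : forall g h, src g = rng h -> rng (gcomp g h) = rng g;
  comp_idl : forall g, gcomp (idn (rng g)) g = g;
  comp_idr : forall g, gcomp g (idn (src g)) = g;
  compA : forall f g h, src f = rng g -> src g = rng h ->
    gcomp f (gcomp g h) = gcomp (gcomp f g) h;
  src_inv : forall g, src (ginv g) = rng g;
  rng_inv : forall g, rng (ginv g) = src g;
  comp_invl : forall g, gcomp (ginv g) g = idn (src g);
  comp_invr : forall g, gcomp g (ginv g) = idn (rng g)
}.

(* hom G x y is xGy, the set of arrows from y to x. *)
Definition hom (Obj Arr : Type) (G : groupoid Obj Arr) (x y : Obj) : set Arr :=
  [set g | rng G g = x /\ src G g = y].

Definition orbit_equiv (Obj Arr : Type) (G : groupoid Obj Arr) (x y : Obj) :=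
  hom G y x !=set0.

Definition orbit_of (Obj Arr : Type) (G : groupoid Obj Arr) (x : Obj) : set Obj :=
  [set y | orbit_equiv G x y].

Definition composable (Obj : Type) (Arr : topologicalType)
    (G : groupoid Obj Arr) : set (Arr * Arr) :=
  [set p | src G p.1 = rng G p.2].

Definition composition (Obj : Type) (Arr : topologicalType)
    (G : groupoid Obj Arr) (p : composable G) : Arr :=
  gcomp G (set_val p).1 (set_val p).2.

(* The embedding condition identifies Obj with the space of identity arrows. *)
Record polish_groupoid (R : realType) (Obj Arr : topologicalType)
    (G : groupoid Obj Arr) : Prop := PolishGroupoid {
  pg_locally_polish : locally_polish R Arr;
  pg_objects : embedding (idn G);
  pg_comp_continuous : continuous (composition (G := G));
  pg_comp_open : open_map (composition (G := G));
  pg_inv_continuous : continuous (ginv G);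
  pg_inv_open : open_map (ginv G);
  pg_polish_objects : polish R Obj;
  pg_polish_src : forall x, polish R (src G @^-1` [set x]);
  pg_polish_rng : forall x, polish R (rng G @^-1` [set x])
}.

Definition is_functor (Obj Arr Obj' Arr' : Type) (G : groupoid Obj Arr)
    (H : groupoid Obj' Arr') (F0 : Obj -> Obj') (F1 : Arr -> Arr') :=
  [/\ forall g, src H (F1 g) = F0 (src G g),
      forall g, rng H (F1 g) = F0 (rng G g),
      forall x, F1 (idn G x) = idn H (F0 x) &
      forall g h, src G g = rng G h ->
        F1 (gcomp G g h) = gcomp H (F1 g) (F1 h)].

Definition E0 (x y : cantor_space) := finite_set [set n | x n <> y n].

Lemma E0_refl x : E0 x x.
Proof. by rewrite /E0 (_ : mkset _ = set0)//; apply/seteqP; split=> n /=. Qed.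

Lemma E0_sym x y : E0 x y -> E0 y x.
Proof. by apply: sub_finite_set => n /= + /esym. Qed.

Lemma E0_trans x y z : E0 x y -> E0 y z -> E0 x z.
Proof.
move=> xy yz; have : finite_set ([set n | x n <> y n] `|` [set n | y n <> z n]).
  by rewrite finite_setU.
apply: sub_finite_set => n /= xz.
by have [xyn|] := pselect (x n = y n); [right; rewrite -xyn|left].
Qed.

(* The arrow (y, x), from x to y. *)
Record E0_arrow := E0Arrow {
  E0_rng : cantor_space;
  E0_src : cantor_space;
  E0_arrowP : E0 E0_src E0_rng
}.

Lemma E0_arrow_eq g h :
  E0_rng g = E0_rng h -> E0_src g = E0_src h -> g = h.
Proof.
by case: g h => [y x p] [y' x' p'] /= yy' xx'; subst; rewrite (Prop_irrelevance p p').
Qed.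

HB.instance Definition _ := gen_eqMixin E0_arrow.
HB.instance Definition _ := gen_choiceMixin E0_arrow.

(* The direct sum of countably many copies of Z/2. *)
Definition fin_seq : set (nat -> bool) :=
  [set g | finite_set [set n | g n = true]].

Lemma E0_translate (g : fin_seq) (x : cantor_space) :
  E0 x (fun n => set_val g n (+) x n).
Proof.
have /set_mem := valP g; apply: sub_finite_set => n /=.
by rewrite set_valE -[sval g]/(\val g); case: (\val g n).
Qed.

Definition E0_chart (p : discrete_topology fin_seq * cantor_space) : E0_arrow :=
  E0Arrow (E0_translate p.1 p.2).

(* The topology making E0_chart a homeomorphism, see E0_chart_homeomorphism. *)
Definition E0_open : set (set E0_arrow) := [set U | open (E0_chart @^-1` U)].

Lemma E0_openT : E0_open setT.
Proof. by rewrite /E0_open /= preimage_setT; exact: openT. Qed.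

Lemma E0_openI : setI_closed E0_open.
Proof. by move=> A B oA oB; rewrite /E0_open /= preimage_setI; exact: openI. Qed.

Lemma E0_open_bigU (I : Type) (f : I -> set E0_arrow) :
  (forall i, E0_open (f i)) -> E0_open (\bigcup_i f i).
Proof.
move=> fo; rewrite /E0_open /= preimage_bigcup.
by apply: bigcup_open => i _; exact: fo.
Qed.

HB.instance Definition _ :=
  isOpenTopological.Build E0_arrow E0_openT E0_openI E0_open_bigU.

Lemma E0_chart_bijective : bijective E0_chart.
Proof.
rewrite -setTT_bijective; split => //.
- move=> [g x] [h y] _ _ e; have exy : x = y by have := congr1 E0_src e.
  subst y; congr pair; apply: val_inj; apply/funext => n.
  have /(congr1 (fun z : cantor_space => z n)) /= := congr1 E0_rng e.
  by move/addIb.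
- move=> [y x xy] _.
  have gP : (fun n => y n (+) x n) \in fin_seq.
    rewrite inE; move: xy; apply: sub_finite_set => n /=.
    by case: (x n); case: (y n).
  exists (exist _ (fun n => y n (+) x n) gP : discrete_topology fin_seq, x) => //; apply: E0_arrow_eq => //=.
  by apply/funext => n; rewrite /set_val /= addbK.
Qed.

Lemma E0_chart_homeomorphism : homeomorphism E0_chart.
Proof.
split; first exact: E0_chart_bijective.
  by apply/continuousP => A.
move=> U oU; rewrite /open /= /E0_open /=.
suff -> : E0_chart @^-1` (E0_chart @` U) = U by [].
apply/seteqP; split=> [p [q Uq] |p Up]; last by exists p.
by move/(bij_inj E0_chart_bijective) => <-.
Qed.

Definition E0_idn (x : cantor_space) : E0_arrow := E0Arrow (E0_refl x).

Definition E0_inv (g : E0_arrow) : E0_arrow := E0Arrow (E0_sym (E0_arrowP g)).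

Lemma E0_comp_subproof g h :
  E0_src g = E0_rng h -> E0 (E0_src h) (E0_rng g).
Proof.
by move=> e; apply: E0_trans (E0_arrowP h) _; rewrite -e; exact: E0_arrowP.
Qed.

(* (z, y)(y, x) = (z, x); the value g is arbitrary if g, h are not composable. *)
Definition E0_comp (g h : E0_arrow) : E0_arrow :=
  if pselect (E0_src g = E0_rng h) is left e
  then E0Arrow (E0_comp_subproof e) else g.

Lemma E0_compE g h : E0_src g = E0_rng h ->
  E0_rng (E0_comp g h) = E0_rng g /\ E0_src (E0_comp g h) = E0_src h.
Proof. by rewrite /E0_comp; case: pselect. Qed.

Lemma E0_compA f g h : E0_src f = E0_rng g -> E0_src g = E0_rng h ->
  E0_comp f (E0_comp g h) = E0_comp (E0_comp f g) h.
Proof.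
move=> fg gh; have [r1 s1] := E0_compE fg; have [r2 s2] := E0_compE gh.
have [r3 s3] : E0_rng (E0_comp f (E0_comp g h)) = E0_rng f /\
    E0_src (E0_comp f (E0_comp g h)) = E0_src (E0_comp g h).
  by apply: E0_compE; rewrite r2.
have [r4 s4] : E0_rng (E0_comp (E0_comp f g) h) = E0_rng (E0_comp f g) /\
    E0_src (E0_comp (E0_comp f g) h) = E0_src h.
  by apply: E0_compE; rewrite s1.
by apply: E0_arrow_eq; rewrite ?r3 ?r4 ?s3 ?s4.
Qed.

Definition E0_groupoid : groupoid cantor_space E0_arrow.
Proof.
refine (@Groupoid _ _ E0_src E0_rng E0_idn E0_comp E0_inv _ _ _ _ _ _ _ _ _ _ _)
  => //.
- by move=> g h /E0_compE[].
- by move=> g h /E0_compE[].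
- by move=> g; have [r s] := @E0_compE (E0_idn (E0_rng g)) g erefl; apply: E0_arrow_eq.
- by move=> g; have [r s] := @E0_compE g (E0_idn (E0_src g)) erefl; apply: E0_arrow_eq.
- exact: E0_compA.
- by move=> g; have [r s] := @E0_compE (E0_inv g) g erefl; apply: E0_arrow_eq.
- by move=> g; have [r s] := @E0_compE g (E0_inv g) erefl; apply: E0_arrow_eq.
Defined.

(* Injectivity and continuity are on arrows; as objects embed as identity
   arrows, both are inherited by F0. *)
Definition E0_embeds (Obj Arr : topologicalType) (G : groupoid Obj Arr) :=
  exists (F0 : cantor_space -> Obj) (F1 : E0_arrow -> Arr),
    [/\ is_functor E0_groupoid G F0 F1, injective F1, continuous F1 &
        forall x y, E0 x y <-> hom G (F0 y) (F0 x) !=set0].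

(* Main.v *)
From HB Require Import structures.
Require Import Defs.
From mathcomp Require Import all_boot all_order all_algebra.
From mathcomp Require Import all_classical all_reals all_analysis.
From mathcomp Require Import borel_hierarchy.
From mathcomp Require Import lra.

(* Let O be an orbit that is not Gdelta and C its closure.  If E_G is meager in C x C,
   a Cantor scheme of finite approximations yields a continuous embedding of E0: the
   dense orbit O provides the connecting arrows, and the nowhere dense sets covering E_G are
   avoided along the way.  If E_G is not meager in C x C, then, being analytic, it is
   comeager in a nonempty open set, so some orbit is comeager in a nonempty open subset
   of C.  Its Vaught transform shows that this orbit is a dense Gdelta subset of C; by
   hypothesis it is also Fsigma, so by Baire it has interior in C and meets, hence
   equals, O, a contradiction.

   If on the other hand all orbits are Gdelta, each is determined by its closure, that
   is, by the basic open sets whose saturations contain it.  As saturations of open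
   sets are open, E_G is then smooth and Gdelta, and orbits are open in their closures
   by the same Baire argument.

   The measure in (4) is the image of the coin tossing measure on the Cantor space,
   for which E0-invariant Borel sets satisfy a 0-1 law; and an ergodic measure for a
   smooth relation is concentrated on one class. *)

Set Implicit Arguments.
Unset Strict Implicit.
Unset Printing Implicit Defensive.

Import Order.TTheory GRing.Theory Num.Theory.
Import numFieldNormedType.Exports.

Local Open Scope classical_set_scope.

(** * Polish spaces *)

(** The space of arrows is only locally Polish and may fail to be Hausdorff. Limits of arrows are
    well controlled only inside one basic open set, so the Cantor scheme yields as limits only
    generating arrows, which flip one bit when all lower bits are null; every other arrow is a
    finite product of these and their inverses. Functoriality then becomes algebra. The scheme can
    be refined because [src] and [rng] are open maps: a single point of an approximation can be
    moved anywhere nearby in C, dragging the others along the connecting arrows, so a dense open set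
    of pairs is entered one pair of words at a time. From a Borel reduction of E0, the measure is
    not pushed forward along the reduction itself but along the continuous embedding: its image is
    compact and its fibres are points, which provides the Borel null sets that cover the orbits. *)

Lemma choice_dep (T : nat -> Type) (R : forall n, T n -> T n.+1 -> Prop) (x0 : T 0) :
  (forall n x, exists y, R n x y) ->
  exists u : forall n, T n, u 0 = x0 /\ forall n, R n (u n) (u n.+1).
Proof.
move=> h.
pose u := nat_rect T x0 (fun n x => projT1 (cid (h n x))).
by exists u; split=> // n; exact: projT2 (cid (h n (u n))).
Qed.

Definition enum_basis (T : topologicalType) (b : nat -> set T) :=
  (forall n, open (b n)) /\
  forall x U, open U -> U x -> exists2 n, b n x & b n `<=` U.

(* Completeness of the subspace S, without a metric: [sm k A] stands for A `&` S
   having diameter of order 1/k with respect to some complete metric on S. *)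
Definition small_sets (T : topologicalType) (S : set T) (sm : nat -> set (set T)) :=
  [/\ forall j k A B, (j <= k)%N -> A `<=` B -> sm k B -> sm j A,
      forall k x U, open U -> U x -> S x -> exists V,
        [/\ open V, V x, closure (V `&` S) `&` S `<=` U & sm k V] &
      forall F : nat -> set T, (forall n, F n.+1 `<=` F n) ->
        (forall n, F n `&` S !=set0) -> (forall n, sm n (F n)) ->
        exists2 l, S l & forall U, open U -> U l -> exists n, F n `&` S `<=` U].

Section complete_distance.
Local Open Scope ring_scope.
Variable R : realType.

Definition natSinv (n : nat) : R := n.+1%:R^-1.

Lemma natSinv_gt0 n : 0 < natSinv n.
Proof. by rewrite invr_gt0 ltr0n. Qed.

Lemma natSinv_le (m n : nat) : (m <= n)%N -> natSinv n <= natSinv m.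
Proof. by move=> mn; rewrite lef_pV2 ?posrE ?ltr0n// ler_nat. Qed.

Lemma exists_natSinv_lt (e : R) : 0 < e -> exists n, natSinv n < e.
Proof.
move=> e0; have [N _ h] := near_infty_natSinv_lt (PosNum e0).
by exists N; apply: h => /=.
Qed.

Record complete_dist (T : topologicalType) (d : T -> T -> R) : Prop := CompleteDist {
  cd_xx : forall x, d x x = 0;
  cd_eq : forall x y, d x y = 0 -> x = y;
  cd_sym : forall x y, d x y = d y x;
  cd_tri : forall y x z, d x z <= d x y + d y z;
  cd_open : forall U : set T, open U <->
    forall x, U x -> exists2 e, 0 < e & forall y, d x y < e -> U y;
  cd_complete : forall u : nat -> T,
    (forall e, 0 < e -> exists N, forall m n, (N <= m)%N -> (N <= n)%N ->
       d (u m) (u n) < e) ->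
    exists l, forall e, 0 < e -> exists N, forall n, (N <= n)%N -> d l (u n) < e
}.

Lemma polish_dist (T : topologicalType) : polish R T ->
  exists d : T -> T -> R, complete_dist d.
Proof.
move=> [_ [M [f [[bf cf opf] cM]]]].
have [g fK gK] := bf.
exists (fun x y => @mdist R M (f x) (f y)); split.
- by move=> x; rewrite mdistxx.
- by move=> x y /mdist_positivity; exact: bij_inj.
- by move=> x y; rewrite metric_sym.
- by move=> y x z; exact: metric_triangle.
- move=> U; split.
    move=> /opf ofU x Ux.
    have : nbhs (f x) (f @` U) by apply: open_nbhs_nbhs; split=> //; exists x.
    rewrite -nbhs_ballE => -[e /= e0 he]; exists e => // y xy.
    have : ball (f x) e (f y) by rewrite ballEmdist.
    by move=> /he [z Uz /(bij_inj bf) <-].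
  move=> h.
  have -> : U = f @^-1` (g @^-1` U) by apply/seteqP; split=> x /=; rewrite fK.
  move/continuousP : cf; apply.
  rewrite openE => y /= Uy; rewrite /interior -nbhs_ballE.
  have [e e0 he] := h _ Uy; exists e => // z; rewrite ballEmdist/= => yz /=.
  by apply: he; rewrite !gK.
- move=> u cu.
  have [|l hl] := cM (f \o u @ \oo).
    move=> E; rewrite -entourage_ballE => -[e /= e0 he].
    have [N hN] := cu _ e0.
    exists ((f \o u) @` [set n | (N <= n)%N], (f \o u) @` [set n | (N <= n)%N]) => /=.
      by split; exists N => // n /= Nn; exists n.
    move=> [_ _] [/= [m Nm <-] [n Nn <-]]; apply: he => /=.
    by rewrite ballEmdist/=; exact: hN.
  exists (g l) => e e0; rewrite gK.
  have [N _ hN] : \forall n \near \oo, ball l e (f (u n)).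
    by apply: hl; exact: nbhsx_ballx.
  by exists N => n /hN/=; rewrite ballEmdist.
Qed.

Section theory.
Variables (T : topologicalType) (d : T -> T -> R).
Hypothesis dP : complete_dist d.

Lemma cd_ball_open x e : open [set y | d x y < e].
Proof.
apply/(cd_open dP) => y /= xy; exists (e - d x y); first by rewrite subr_gt0.
move=> z yz; apply: le_lt_trans (cd_tri dP y x z) _; lra.
Qed.

(** Smallness of order [k] means that the trace lies in one ball of radius [1 / (k + 1)]. A general
    map [j] inducing the topology serves both for a whole space and for the inclusion of a
    subspace. *)
Lemma cd_small_sets (T' : topologicalType) (j : T -> T') :
  (forall U : set T, open U <-> exists2 V, open V & U = j @^-1` V) ->
  exists sm, small_sets (range j) sm.
Proof.
move=> hj.
have jopen V : open V -> open (j @^-1` V) by move=> oV; apply/hj; exists V.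
exists (fun k A => exists c, forall y, A (j y) -> d c y < natSinv k); split.
- move=> i k A B ik AB [c h]; exists c => y /AB /h; move/lt_le_trans; apply.
  exact: natSinv_le.
- move=> k x' U oU + [x _ ex]; rewrite -{}ex => Ux.
  have /(cd_open dP)/(_ _ Ux) [e e0 he] := jopen _ oU.
  (* Half of [e] is for the ball, the other half for passing to the closure of its trace. *)
  pose r := Num.min (e / 2) (natSinv k).
  have r0 : 0 < r by rewrite lt_min divr_gt0//= natSinv_gt0.
  have re : r <= e / 2 by rewrite ge_min lexx.
  have rk : r <= natSinv k by rewrite ge_min lexx orbT.
  have /hj [V oV eV] := cd_ball_open x r.
  have Vj y : V (j y) <-> d x y < r.
    by change ((j @^-1` V) y <-> d x y < r); rewrite -eV.
  exists V; split=> //.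
  + by apply/Vj; rewrite (cd_xx dP).
  + move=> y' [+ [y _ ey]]; rewrite -{}ey => cy; apply: he.
    have /hj [W oW eW] := cd_ball_open y (e / 2).
    have Wj z : W (j z) <-> d y z < e / 2.
      by change ((j @^-1` W) z <-> d y z < e / 2); rewrite -eW.
    have [|z' [[+ [z _ ez]]]] := cy W; last rewrite -{}ez.
      apply: open_nbhs_nbhs; split=> //; apply/Wj; rewrite (cd_xx dP); lra.
    move=> /Vj xz /Wj; rewrite (cd_sym dP) => yz.
    by have := cd_tri dP z x y; lra.
  + by exists x => y /Vj xy; exact: lt_le_trans rk.
- move=> F Fd F0 sF.
  have Fm m n : (m <= n)%N -> F n `<=` F m.
    elim: n => [|n IH]; first by rewrite leqn0 => /eqP ->.
    by rewrite leq_eqVlt => /orP[/eqP -> //|/IH]; apply: subset_trans; exact: Fd.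
  have /choice[u uF] : forall n, exists y, F n (j y).
    by move=> n; have [x [Fx [y _ ey]]] := F0 n; exists y; rewrite ey.
  have near n y z : F n (j y) -> F n (j z) -> d y z < natSinv n + natSinv n.
    move=> Fy Fz; have [c hc] := sF n.
    have := cd_tri dP c y z; rewrite (cd_sym dP y c).
    by have := hc _ Fy; have := hc _ Fz; lra.
  have [|l hl] := cd_complete dP (u := u).
    move=> e e0; have [|N hN] := @exists_natSinv_lt (e / 2); first lra.
    exists N => m n Nm Nn.
    have := near N (u m) (u n) (Fm _ _ Nm _ (uF m)) (Fm _ _ Nn _ (uF n)).
    lra.
  exists (j l); first by exists l.
  move=> U oU Ul.
  have /(cd_open dP)/(_ _ Ul) [e e0 he] := jopen _ oU.
  have [|N hN] := @exists_natSinv_lt (e / 3); first lra.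
  have [|N' hN'] := hl (e / 3); first lra.
  exists N => y' [+ [y _ ey]]; rewrite -{}ey => Fy; apply: he.
  have h1 := hN' _ (leq_maxr N N').
  have h2 := near N _ _ (Fm _ _ (leq_maxl N N') _ (uF (maxn N N'))) Fy.
  by have := cd_tri dP (u (maxn N N')) l y; lra.
Qed.

Lemma cd_hausdorff : hausdorff_space T.
Proof.
move=> x y xy; apply: (cd_eq dP); apply/eqP; rewrite eq_le; apply/andP; split; last first.
  by have := cd_tri dP y x x; rewrite (cd_xx dP) (cd_sym dP y x); lra.
rewrite leNgt; apply/negP => xy0.
have nb z : nbhs z [set t | d z t < d x y / 2].
  apply: open_nbhs_nbhs; split; first exact: cd_ball_open.
  by rewrite /= (cd_xx dP); lra.
have [z [/= xz yz]] := xy _ _ (nb x) (nb y).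
by have := cd_tri dP z x y; rewrite (cd_sym dP z y); lra.
Qed.

End theory.

Lemma polish_small_sets (T : topologicalType) : polish R T ->
  exists sm, @small_sets T setT sm.
Proof.
move=> /polish_dist[d dP]; have [|sm smP] := @cd_small_sets _ _ dP T id.
  by move=> U; split=> [oU|[V oV ->]]; [exists U|].
by exists sm; move: smP; rewrite image_id.
Qed.

Lemma polish_sub_small_sets (T : topologicalType) (S : set T) : polish R S ->
  exists sm, small_sets S sm.
Proof.
move=> /polish_dist[d dP]; have [|sm smP] := @cd_small_sets _ _ dP T set_val.
  move=> U; split=> [[V oV <-]|[V oV ->]]; first by exists V.
  by exists V.
exists sm; move: smP; suff -> : range (set_val : S -> T) = S by [].
apply/seteqP; split=> [_ [x _ <-]|x Sx]; first exact: set_valP.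
by exists (exist _ x (mem_set Sx)).
Qed.

Lemma polish_hausdorff (T : topologicalType) : polish R T -> hausdorff_space T.
Proof. by move=> /polish_dist[d /cd_hausdorff]. Qed.

Lemma polish_basis (T : topologicalType) : polish R T ->
  exists b : nat -> set T, enum_basis b.
Proof.
move=> pT; have [d dP] := polish_dist pT; have [[D cD dD] _] := pT.
have /pcard_injP[g] := cD.
move=> injg.
(* The code of a centre and the index of a radius are packed into one number; numbers that decode to
   nothing give the empty set. The same device later lists families of dense open sets, with default
   [setT]. *)
pose b n := if unpickle n is Some (k, j) then
  [set y | exists x, [/\ D x, g x = k & d x y < natSinv j]] else set0.
exists b; split.
  move=> n; rewrite /b; case: unpickle => [[k j]|]; last exact: open0.
  rewrite (_ : mkset _ = \bigcup_(x in [set x | D x /\ g x = k]) [set y | d x y < natSinv j]).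
    by apply: bigcup_open => x _; exact: cd_ball_open.
  apply/seteqP; split=> [y [x [Dx gx xy]]|y [x [Dx gx] xy]]; by exists x.
move=> x U oU Ux.
have /(cd_open dP)/(_ _ Ux) [e e0 he] := oU.
have [|j hj] := @exists_natSinv_lt (e / 2); first lra.
have [||y [/= xy Dy]] := dD [set y | d x y < natSinv j].
- by exists x => /=; rewrite (cd_xx dP) natSinv_gt0.
- exact: cd_ball_open.
exists (pickle (g y, j)).
  by rewrite /b pickleK; exists y; split; rewrite // (cd_sym dP).
rewrite /b pickleK => z [y' [Dy' /injg ey yz]]; apply: he.
move: yz; rewrite ey ?inE// => yz.
have := cd_tri dP y x z; lra.
Qed.

End complete_distance.

(** * Baire category *)

Lemma open_setX (S T : topologicalType) (A : set S) (B : set T) :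
  open A -> open B -> open (A `*` B).
Proof.
move=> oA oB; rewrite openE => -[x y] [/= Ax By].
by exists (A, B) => //; split; exact: open_nbhs_nbhs.
Qed.

Section category.
Variable T : topologicalType.
Implicit Types S A : set T.

(** Density, the Baire property and meagerness are relative to [S] but speak only of open and closed
    sets of [T], so that no subspace type has to be handled. A nowhere dense set is represented by a
    closed set whose complement is dense in [S]. *)
Definition dense_in S A :=
  forall W, open W -> W `&` S !=set0 -> W `&` A `&` S !=set0.

Definition baire S := forall U (A : nat -> set T), open U -> U `&` S !=set0 ->
  (forall n, open (A n)) -> (forall n, dense_in S (A n)) ->
  exists x, [/\ S x, U x & forall n, A n x].

Definition meager_in S A := exists N : nat -> set T,
  [/\ forall n, closed (N n), forall n, dense_in S (~` N n) &
      A `&` S `<=` \bigcup_n N n].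

Lemma small_sets_baire S sm : small_sets S sm -> baire S.
Proof.
move=> [smS sm_ex sm_lim] U A oU US oA dA.
pose St := {V : set T | open V /\ V `&` S !=set0}.
have [|u [u0 uS]] := @choice_dep (fun=> St) (fun n V V' =>
    [/\ sval V' `<=` sval V, closure (sval V' `&` S) `&` S `<=` sval V `&` A n &
        sm n (sval V')]) (exist _ U (conj oU US)).
  move=> n [V [oV VS]] /=.
  have [x [[Vx Ax] Sx]] := dA n V oV VS.
  have [W [oW Wx cW sW]] : exists W, [/\ open W, W x,
      closure (W `&` S) `&` S `<=` V `&` A n & sm n W].
    by apply: sm_ex => //; exact: openI.
  have oVW : open (V `&` W) by apply: openI.
  have VWS : (V `&` W) `&` S !=set0 by exists x.
  exists (exist _ (V `&` W) (conj oVW VWS)) => /=; split.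
  - exact: subIsetl.
  - apply: subset_trans cW; apply: setSI; apply: closureS; apply: setSI.
    exact: subIsetr.
  - by apply: smS sW => //; exact: subIsetr.
have [|||l Sl hl] := sm_lim (fun n => sval (u n.+1)).
- by move=> n; have [] := uS n.+1.
- by move=> n; case: (u n.+1) => V [].
- by move=> n; have [] := uS n.
have lu n : sval (u n) l /\ A n l.
  have [_ h _] := uS n; apply: h; split=> // W Wl.
  have [m hm] := hl (interior W) (open_interior _) Wl.
  have mono k j : sval (u (k + j)%N) `<=` sval (u k).
    elim: j => [|j IH]; first by rewrite addn0.
    by rewrite addnS; apply: subset_trans IH; have [] := uS (k + j)%N.
  have [x [ux Sx]] : sval (u (n.+1 + m.+1)%N) `&` S !=set0.
    by case: (u _) => V [].
  exists x; split; first by split=> //; exact: mono ux.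
  by apply: interior_subset; apply: hm; split=> //; apply: (mono _ n.+1); rewrite addnC.
exists l; split=> //; last by move=> n; have [] := lu n.
by have [+ _] := lu 0%N; rewrite u0.
Qed.

Lemma small_sets_closed S C sm : closed C -> C `<=` S ->
  small_sets S sm -> small_sets C sm.
Proof.
move=> cC CS [smS sm_ex sm_lim]; split=> //.
- move=> k x U oU Ux Cx; have [V [oV Vx cV sV]] := sm_ex k x U oU Ux (CS _ Cx).
  exists V; split=> // y [cy Cy]; apply: cV; split; last exact: CS.
  by apply: closureS cy; apply: setIS.
- move=> F Fd F0 sF; have [//||//|l Sl hl] := sm_lim F.
    by move=> n; have [x [Fx Cx]] := F0 n; exists x; split=> //; exact: CS.
  exists l.
    apply: cC => W; rewrite nbhsE => -[W' [oW' W'l] W'W].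
    have [n hn] := hl _ oW' W'l; have [x [Fx Cx]] := F0 n.
    by exists x; split=> //; apply: W'W; apply: hn; split=> //; exact: CS.
  by move=> U oU Ul; have [n hn] := hl U oU Ul; exists n; apply: subset_trans hn; apply: setIS.
Qed.

Lemma dense_inI S A B :
  open A -> dense_in S A -> dense_in S B -> dense_in S (A `&` B).
Proof.
move=> oA dA dB W oW /(dA W oW)[x [[Wx Ax] Sx]].
have [|y [[[Wy Ay] By] Sy]] := dB (W `&` A) (openI oW oA); first by exists x.
by exists y.
Qed.

Lemma meager_in_sub S A B : A `<=` B -> meager_in S B -> meager_in S A.
Proof.
by move=> AB [N [cN dN AN]]; exists N; split=> //; apply: subset_trans AN; apply: setSI.
Qed.

Lemma meager_in_closed S A : closed A -> dense_in S (~` A) -> meager_in S A.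
Proof. by move=> cA dA; exists (fun=> A); split=> // x [Ax _]; exists 0%N. Qed.

Lemma meager_in0 S : meager_in S set0.
Proof.
by apply: meager_in_closed closed0 _ => W _; rewrite setC0 setIT.
Qed.

Lemma meager_in_bigcup S (A : nat -> set T) :
  (forall n, meager_in S (A n)) -> meager_in S (\bigcup_n A n).
Proof.
move=> /choice[N hN].
exists (fun n => if unpickle n is Some (i, j) then N i j else set0); split.
- move=> n; case: unpickle => [[i j]|]; last exact: closed0.
  by have [] := hN i.
- move=> n; case: unpickle => [[i j]|]; first by have [] := hN i.
  by move=> W _; rewrite setC0 setIT.
- move=> x [[i _ Ax] Sx]; have [_ _ h] := hN i.
  have [j _ Nx] := h x (conj Ax Sx).
  by exists (pickle (i, j)) => //; rewrite pickleK.
Qed.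

Lemma meager_inU S A B : meager_in S A -> meager_in S B -> meager_in S (A `|` B).
Proof.
move=> mA mB; apply: meager_in_sub (meager_in_bigcup (A := fun n => if n is 0 then A else B) _).
  by move=> x [Ax|Bx]; [exists 0%N|exists 1%N].
by case.
Qed.

End category.

(** * Points near which a set is nonmeager *)

Section nonmeager_points.
Variables (T : topologicalType) (b : nat -> set T) (S : set T).
Hypothesis bP : enum_basis b.
Implicit Types A : set T.

(** Kuratowski's operator of local nonmeagerness. Its interior relative to [S] is represented below
    by [nonmeager_int], an open set of the ambient space. *)
Definition nonmeager_pts A :=
  [set y | forall U, open U -> U y -> ~ meager_in S (U `&` A)].

Definition nonmeager_int A :=
  \bigcup_(U in [set U | open U /\ U `&` S `<=` nonmeager_pts A]) U.

Lemma nonmeager_pts_closed A : closed (nonmeager_pts A).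
Proof.
move=> x cx U oU Ux; have [y [Dy Uy]] := cx U (open_nbhs_nbhs (conj oU Ux)).
exact: Dy.
Qed.

Lemma nonmeager_int_open A : open (nonmeager_int A).
Proof. by apply: bigcup_open => U []. Qed.

Lemma nonmeager_int_sub A : nonmeager_int A `&` S `<=` nonmeager_pts A.
Proof. by move=> x [[U [oU US] Ux] Sx]; apply: US. Qed.

(** Each point of the difference has a basic neighbourhood in which [A] is meager, and there are
    only countably many basic sets. *)
Lemma meager_setD_pts A : meager_in S (A `\` nonmeager_pts A).
Proof.
pose B n := if pselect (meager_in S (b n `&` A)) then b n `&` A else set0.
apply: meager_in_sub (meager_in_bigcup (A := B) _).
  move=> x [Ax] /existsNP[U /not_implyP[oU /not_implyP[Ux /contrapT mU]]].
  have [n bx bU] := bP.2 _ _ oU Ux.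
  exists n => //; rewrite /B; case: pselect => // -[].
  by apply: meager_in_sub mU; apply: setSI.
by move=> n; rewrite /B; case: pselect => [m|m] //; exact: meager_in0.
Qed.

Lemma meager_pts_setD_int A : meager_in S (nonmeager_pts A `\` nonmeager_int A).
Proof.
apply: meager_in_closed.
  by apply: closedI; [exact: nonmeager_pts_closed|exact/open_closedC/nonmeager_int_open].
move=> W oW [x [Wx Sx]].
have [h|/existsNP[y /not_implyP[[Wy Sy] Dy]]] :=
  pselect (W `&` S `<=` nonmeager_pts A).
  by exists x; split=> //; split=> // -[_]; apply; exists W.
by exists y; split=> //; split=> // -[].
Qed.

(** On an open set violating density, each point of [A] would lie in some [B i] without lying in
    [nonmeager_int (B i)]. Such points form a meager set, whereas [A] is nonmeager near every point
    there. *)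
Lemma nonmeager_pts_cover A (I : set nat) (B : nat -> set T) :
  A `<=` \bigcup_(i in I) B i ->
  dense_in S (~` (nonmeager_pts A `\` \bigcup_(i in I) nonmeager_int (B i))).
Proof.
move=> AB W oW [x [Wx Sx]]; apply: contrapT => hW.
have {}hW : W `&` S `<=` nonmeager_pts A `\` \bigcup_(i in I) nonmeager_int (B i).
  by move=> y [Wy Sy]; apply: contrapT => Ny; apply: hW; exists y.
have [Dx _] := hW _ (conj Wx Sx).
apply: (Dx W oW Wx).
pose M i := if pselect (I i) then (B i `\` nonmeager_pts (B i)) `|`
  (nonmeager_pts (B i) `\` nonmeager_int (B i)) else set0.
have mM : meager_in S (\bigcup_i M i).
  apply: meager_in_bigcup => i; rewrite /M; case: pselect => [Ii|nIi]; last exact: meager_in0.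
  by apply: meager_inU; [exact: meager_setD_pts|exact: meager_pts_setD_int].
have [N [cN dN MN]] := mM; exists N; split=> // y [[Wy Ay] Sy]; apply: MN; split=> //.
have [i Ii By] := AB _ Ay; exists i => //; rewrite /M; case: pselect => [p|//].
have [_ nI] := hW _ (conj Wy Sy).
have [Dy|Dy] := pselect (nonmeager_pts (B i) y); [right|left]; split=> //.
by move=> Iy; apply: nI; exists i.
Qed.

End nonmeager_points.

(* A weaker form of completeness for spaces that are only locally Polish, hence
   possibly not Hausdorff: limits exist but need not be unique. *)
Definition limit_sets (T : topologicalType) (b : nat -> set T)
    (sm : nat -> set (set T)) :=
  (forall k x U, open U -> U x -> exists V,
     [/\ open V, V x, V `<=` U &
        forall j A, (j <= k)%N -> A x -> A `<=` V -> sm j A]) /\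
  (forall F : nat -> set T, (forall n, F n.+1 `<=` F n) ->
     (forall n, F n !=set0) -> (forall n, sm n (F n)) ->
     forall i n, F n `<=` b i ->
     exists2 l, b i l & forall U, open U -> U l -> exists m, F m `<=` U).

(* The Baire property of analytic sets: outside of the nowhere dense sets N below,
   every y near which the image is nonmeager is the image of the limit of a
   shrinking sequence of basic sets whose images are nonmeager near y. *)
Lemma nonmeager_image (P X : topologicalType) (f : P -> X) (bP : nat -> set P)
    (sm : nat -> set (set P)) (bX : nat -> set X) (S : set X) :
  limit_sets bP sm -> enum_basis bP -> enum_basis bX -> continuous f ->
  hausdorff_space X -> ~ meager_in S (range f) ->
  exists V (A : nat -> set X), [/\ open V, V `&` S !=set0, forall n, open (A n),
    forall n, dense_in S (A n) &
    forall y, V y -> S y -> (forall n, A n y) -> range f y].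
Proof.
move=> [sm_ex sm_lim] bPP bXP cf hX nm.
pose D := nonmeager_pts S; pose J := nonmeager_int S.
(* The exceptional set where passing from [B] to a basic piece of order [n] may lose the
   nonmeagerness of the image. *)
pose N B n := D (f @` B) `\` \bigcup_(j in [set j | bP j `<=` B /\ sm n (bP j)]) J (f @` bP j).
have cN B n : closed (N B n).
  apply: closedI; first exact: nonmeager_pts_closed.
  apply: open_closedC; apply: bigcup_open => j _; exact: nonmeager_int_open.
have dN B n : open B -> dense_in S (~` N B n).
  move=> oB; apply: (nonmeager_pts_cover bXP) => _ [x Bx <-].
  have [V [oV Vx VB sV]] := sm_ex n x B oB Bx.
  have [j jx jV] := bPP.2 _ _ oV Vx.
  by exists j; [split; [exact: subset_trans VB|exact: sV]|exists x].
(* Index 0 is reserved for the whole space, which starts the sequence of pieces and need not be a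
   basic set. *)
pose A k := if k is k'.+1 then
  if unpickle k' is Some (i, n) then ~` N (bP i) n else setT
  else ~` N setT 0%N.
exists (J (range f)), A; split.
- exact: nonmeager_int_open.
- apply/set0P/eqP => J0; apply: nm.
  have := meager_inU (meager_setD_pts S bXP (range f)) (meager_pts_setD_int S (range f)).
  move=> [M [cM dM hM]]; exists M; split=> // y [fy Sy]; apply: hM; split=> //.
  have [Dy|Dy] := pselect (nonmeager_pts S (range f) y); [right|left]; split=> //.
  by move=> Jy; have : (J (range f) `&` S) y by []; rewrite J0.
- move=> [|n]; rewrite /A; first exact: closed_openC.
  case: unpickle => [[i m]|]; [exact: closed_openC|exact: openT].
- move=> [|n]; rewrite /A; first exact/dN/openT.
  case: unpickle => [[i m]|]; first exact/dN/bPP.1.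
  by move=> W _; rewrite setIT.
move=> y Jy Sy Ay.
have step B n : ~ N B n y -> D (f @` B) y ->
    exists j, [/\ bP j `<=` B, sm n (bP j) & D (f @` bP j) y].
  move=> nN Dy; have [[j [jB sj] Jj]|h] := pselect
      ((\bigcup_(j in [set j | bP j `<=` B /\ sm n (bP j)]) J (f @` bP j)) y).
    by exists j; split=> //; exact: nonmeager_int_sub.
  by exfalso; apply: nN.
have Nn i n : ~ N (bP i) n y by have := Ay (pickle (i, n)).+1; rewrite /A pickleK.
have [j0 [_ s0 D0]] : exists j, [/\ bP j `<=` setT, sm 0%N (bP j) & D (f @` bP j) y].
  by apply: step; [exact: (Ay 0%N)|exact: nonmeager_int_sub].
pose St := {j | D (f @` bP j) y}.
have [|u [u0 uS]] := @choice_dep (fun=> St) (fun n j j' =>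
    bP (sval j') `<=` bP (sval j) /\ sm n.+1 (bP (sval j'))) (exist _ j0 D0).
  move=> n [j Dj]; have [j' [jj' sj' Dj']] := step _ _ (Nn j n.+1) Dj.
  by exists (exist _ j' Dj').
have Du n U : open U -> U y -> exists2 x, bP (sval (u n)) x & U (f x).
  move=> oU Uy; case: (u n) => j /= Dj; apply: contrapT => h.
  apply: (Dj U oU Uy); rewrite (_ : _ `&` _ = set0); first exact: meager_in0.
  by apply/seteqP; split=> // z [Uz [x bx fx]]; apply: h; exists x => //; rewrite fx.
have [|||p _ hp] := sm_lim (fun n => bP (sval (u n))) _ _ _ (sval (u 0%N)) 0%N (@subset_refl _ _).
- by move=> n; have [] := uS n.
- by move=> n; have [x bx _] := Du n setT openT I; exists x.
- by case=> [|n]; [rewrite u0|have [] := uS n].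
(* Every neighbourhood of [f p] contains the image of some piece, and the image of every piece comes
   arbitrarily near [y]; in a Hausdorff space this forces [f p = y]. *)
exists p => //; apply: hX => V W; rewrite nbhsE => -[V' [oV' V'p] V'V].
rewrite nbhsE => -[W' [oW' W'y] W'W].
have [n hn] := hp (f @^-1` V') ((continuousP f).1 cf _ oV') V'p.
have [x bx W'x] := Du n W' oW' W'y.
by exists (f x); split; [apply: V'V; exact: hn|exact: W'W].
Qed.

(* Half of the Kuratowski-Ulam theorem. *)
Lemma comeager_section (T : topologicalType) (b : nat -> set T) (C : set T)
    (V : set (T * T)) (A : nat -> set (T * T)) :
  enum_basis b -> baire C -> open V -> V `&` (C `*` C) !=set0 ->
  (forall n, open (A n)) -> (forall n, dense_in (C `*` C) (A n)) ->
  exists U x, [/\ C x, open U, U `&` C !=set0, forall y, U y -> V (y, x) &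
    forall n W, open W -> W `<=` U -> W `&` C !=set0 ->
      W `&` [set y | A n (y, x)] `&` C !=set0].
Proof.
move=> bP bC oV [[y0 x0] [Vyx [/= Cy0 Cx0]]] oA dA.
have [[U U'] [/= nU nU'] hUU'] : nbhs (y0, x0) V by apply: open_nbhs_nbhs.
move: nU nU'; rewrite !nbhsE => -[U1 [oU1 U1y] U1U] [V1 [oV1 V1x] V1U'].
(* The points whose section of [A n] meets [C] inside [b i] and [U1]. These sets are open and dense
   in [C], and at a point of [V1] common to all of them every section is dense in [U1]. *)
pose D k := if unpickle k is Some (n, i) then
  if pselect ((b i `&` U1) `&` C !=set0) then
    [set x | exists y, [/\ (b i `&` U1) y, C y & A n (y, x)]] else setT else setT.
have [||k|k|x [Cx V1x' Dx]] := bC V1 D.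
- exact: oV1.
- by exists x0.
- rewrite /D; case: unpickle => [[n i]|]; last exact: openT.
  case: pselect => [e|ne]; last exact: openT.
  rewrite openE => x [y [by_ Cy Ayx]]; have [[P Q] [/= nP nQ] hPQ] : nbhs (y, x) (A n).
    exact: open_nbhs_nbhs.
  apply: filterS nQ => z Qz; exists y; split=> //; apply: hPQ; split=> //.
  exact: nbhs_singleton.
- rewrite /D; case: unpickle => [[n i]|]; last by move=> W _; rewrite setIT.
  case: pselect => [[y [by_ Cy]]|p]; last by move=> W _; rewrite setIT.
  move=> W oW [x [Wx Cx]].
  have [||[y' x'] [[[/= by' Wx'] Ayx'] [/= Cy' Cx']]] := dA n ((b i `&` U1) `*` W).
  + by apply: open_setX => //; apply: openI => //; exact: bP.1.
  + by exists (y, x).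
  + by exists x'; split=> //; split=> //; exists y'.
exists U1, x; split=> //.
- by exists y0.
- by move=> y U1y'; apply: hUU'; split; [exact: U1U|exact: V1U'].
- move=> n W oW WU [y [Wy Cy]]; have [i biy biW] := bP.2 _ _ oW Wy.
  have := Dx (pickle (n, i)); rewrite /D pickleK.
  case: pselect => [p [y' [[by' Uy'] Cy' Ay']]|[]]; last first.
    by exists y; split=> //; split=> //; exact: WU.
  by exists y'; split=> //; split=> //; exact: biW.
Qed.

(** * Polish groupoids and Effros' theorem *)

(** Density is known only inside [U]. Adding to each [A n] the exterior of the trace of [U] makes it
    dense everywhere and adds no point of that trace. *)
Lemma baire_local (T : topologicalType) (S : set T) U (A : nat -> set T) :
  baire S -> open U -> U `&` S !=set0 -> (forall n, open (A n)) ->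
  (forall n W, open W -> W `<=` U -> W `&` S !=set0 -> W `&` A n `&` S !=set0) ->
  exists x, [/\ S x, U x & forall n, A n x].
Proof.
move=> bS oU US oA dA.
have [|||n|x [Sx Ux Ax]] := bS U (fun n => A n `|` ~` closure (U `&` S)) => //.
- by move=> n; apply: openU => //; exact/closed_openC/closed_closure.
- move=> W oW [z [Wz Sz]].
  have [[y [[Uy Wy] Sy]]|h] := pselect (U `&` W `&` S !=set0).
    have [|||y' [[[Uy' Wy'] Ay'] Sy']] := dA n (U `&` W).
    + exact: openI.
    + by move=> z' [].
    + by exists y.
    + by exists y'; split=> //; split=> //; left.
  exists z; split=> //; split=> //; right => cz; apply: h.
  have [y [[Uy Sy] Wy]] := cz W (open_nbhs_nbhs (conj oW Wz)).
  by exists y.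
exists x; split=> // n; have [//|] := Ax n.
by case; exact: subset_closure.
Qed.

Lemma enum_basis_prod (S T : topologicalType) (b : nat -> set S) (c : nat -> set T) :
  enum_basis b -> enum_basis c -> exists d : nat -> set (S * T), enum_basis d.
Proof.
move=> [ob hb] [oc hc].
exists (fun k => if unpickle k is Some (i, j) then b i `*` c j else set0); split.
  move=> k; case: unpickle => [[i j]|]; [exact: open_setX|exact: open0].
move=> [x y] U oU Uxy; have [[V W] [/= nV nW] VWU] : nbhs (x, y) U by exact: open_nbhs_nbhs.
move: nV nW; rewrite !nbhsE => -[V' [oV' V'x] V'V] [W' [oW' W'y] W'W].
have [i bi biV] := hb _ _ oV' V'x; have [j cj cjW] := hc _ _ oW' W'y.
exists (pickle (i, j)); rewrite pickleK; first by split.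
by move=> [u v] [/= bu cv]; apply: VWU; split; [apply/V'V/biV|apply/W'W/cjW].
Qed.

Lemma hausdorff_prod (S T : topologicalType) :
  hausdorff_space S -> hausdorff_space T -> hausdorff_space (S * T)%type.
Proof.
move=> hS hT [x y] [x' y'] h; congr pair; [apply: hS|apply: hT] => A B nA nB.
  have [||[u v] [[/= Au _] [/= Bu _]]] := h (A `*` setT) (B `*` setT).
  - by exists (A, setT) => //; split=> //; exact: filterT.
  - by exists (B, setT) => //; split=> //; exact: filterT.
  by exists u.
have [||[u v] [[/= _ Au] [/= _ Bu]]] := h (setT `*` A) (setT `*` B).
- by exists (setT, A) => //; split=> //; exact: filterT.
- by exists (setT, B) => //; split=> //; exact: filterT.
by exists v.
Qed.

Section Gdelta.
Variable T : topologicalType.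
Implicit Types A B : set T.

Lemma Gdelta_bigcap (A : nat -> set T) :
  (forall n, Gdelta (A n)) -> Gdelta (\bigcap_n A n).
Proof.
move=> hA.
have /choice[F hF] : forall n, exists F : nat -> set T,
    (forall i, open (F i)) /\ A n = \bigcap_i F i.
  by move=> n; have [F oF ->] := hA n; exists F.
exists (fun k => if unpickle k is Some (n, i) then F n i else setT).
  by move=> k; case: unpickle => [[n i]|]; [have [] := hF n|exact: openT].
apply/seteqP; split=> x h.
  move=> k _; case: unpickle => [[n i]|//].
  by have := h n I; rewrite (hF n).2; apply.
move=> n _; rewrite (hF n).2 => i _.
by have := h (pickle (n, i)) I; rewrite pickleK.
Qed.

Lemma GdeltaI A B : Gdelta A -> Gdelta B -> Gdelta (A `&` B).
Proof.
move=> gA gB; rewrite (_ : A `&` B = \bigcap_n (if n is 0 then A else B)).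
  by apply: Gdelta_bigcap; case.
apply/seteqP; split=> [x [Ax Bx] [|n]//|x h].
by split; [exact: (h 0%N)|exact: (h 1%N)].
Qed.

Lemma GdeltaU_open A B : Gdelta A -> open B -> Gdelta (A `|` B).
Proof.
move=> [F oF ->] oB; exists (fun n => F n `|` B); first by move=> n; exact: openU.
apply/seteqP; split=> x.
  by move=> [h|Bx] n _; [left; exact: h|right].
move=> h; have [Bx|nB] := pselect (B x); [by right|left=> n _].
by have [|] := h n I.
Qed.

(** By regularity the complement of [A] is covered by the countably many basic sets whose closures
    miss [A]. *)
Lemma closed_Gdelta (b : nat -> set T) sm A : enum_basis b -> @small_sets T setT sm ->
  closed A -> Gdelta A.
Proof.
move=> bP [_ sm_ex _] cA.
pose F n := if pselect (closure (b n) `<=` ~` A) then ~` closure (b n) else setT.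
exists F.
  move=> n; rewrite /F; case: pselect => [h|h]; last exact: openT.
  exact/closed_openC/closed_closure.
apply/seteqP; split=> x Ax.
  by move=> n _; rewrite /F; case: pselect => [h|//] /h; exact.
apply: contrapT => nA.
have [V [oV Vx cV _]] := sm_ex 0%N x (~` A) (closed_openC cA) nA I.
have [n bx bV] := bP.2 _ _ oV Vx.
have := Ax n I; rewrite /F; case: pselect => [h|[] y cy].
  by move=> ncx; apply: ncx; exact: subset_closure.
by apply: cV; split=> //; rewrite setIT; exact: closureS bV _ cy.
Qed.

Lemma Gdelta_Fsigma_interior (C A : set T) : baire C -> A !=set0 ->
  A `<=` C -> C `<=` closure A -> Gdelta A -> Fsigma A ->
  exists W, [/\ open W, W `&` C !=set0 & W `&` C `<=` A].
Proof.
move=> bC [a Aa] AC CA [B oB AB] [F cF AF]; apply: contrapT => h.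
(* Even indices carry the open sets whose intersection is [A], odd ones the complements of the
   closed sets whose union is [A]. The latter are dense because [A] is assumed to have no relative
   interior; a common point is both in [A] and outside it. *)
have [|||k|y [Cy _ By]] := bC setT (fun k => if odd k then ~` F k./2 else B k./2).
- exact: openT.
- by exists a; split=> //; exact: AC.
- by move=> k; case: odd => //; exact: closed_openC.
- case: ifP => _ W oW [z [Wz Cz]].
    have /existsNP[y /not_implyP[[Wy Cy] nA]] : ~ (W `&` C `<=` A).
      by move=> WA; apply: h; exists W; split=> //; exists z.
    by exists y; split=> //; split=> // Fy; apply: nA; rewrite AF; exists k./2.
  have [y [Ay Wy]] := CA _ Cz W (open_nbhs_nbhs (conj oW Wz)).
  exists y; split; last exact: AC.
  by split=> //; move: Ay; rewrite AB; apply.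
have : A y by rewrite AB => n _; have := By n.*2; rewrite odd_double doubleK.
rewrite AF => -[n _ Fy]; have := By n.*2.+1.
by rewrite /= odd_double /= uphalf_double; exact.
Qed.

End Gdelta.

Lemma polish_closed_Gdelta (R : realType) (T : topologicalType) (A : set T) :
  polish R T -> closed A -> Gdelta A.
Proof.
by move=> pT; have [b bP] := polish_basis pT; have [sm smP] := polish_small_sets pT;
  exact: closed_Gdelta bP smP.
Qed.

Lemma polish_closed_small_sets (R : realType) (T : topologicalType) (A : set T) :
  polish R T -> closed A -> exists sm, small_sets A sm.
Proof.
move=> /polish_small_sets[sm smP] cA; exists sm.
by apply: small_sets_closed smP.
Qed.

Lemma polish_closed_baire (R : realType) (T : topologicalType) (A : set T) :
  polish R T -> closed A -> baire A.
Proof.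
by move=> pT cA; have [sm] := polish_closed_small_sets pT cA; exact: small_sets_baire.
Qed.

Lemma locally_polish_basis (R : realType) (T : topologicalType) :
  locally_polish R T -> exists b : nat -> set T, enum_basis b /\
    forall n, exists sm, small_sets (b n) sm.
Proof.
move=> [B [/pcard_injP[g ginj] [oB nB] pB]].
(* At most one member of [B] has code [n], so this is that member or the empty set, for which
   completeness is vacuous. *)
pose b n := \bigcup_(U in [set U | B U /\ g U = n]) U.
have bE U : B U -> b (g U) = U.
  move=> BU; apply/seteqP; split=> [x [V [BV /ginj eV] Vx]|x Ux].
    by rewrite -eV ?inE.
  by exists U.
exists b; split.
  split=> [n|x U oU Ux]; first by apply: bigcup_open => U [BU _]; exact: oB.
  have [V [BV Vx] VU] := nB x U (open_nbhs_nbhs (conj oU Ux)).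
  by exists (g V); rewrite bE.
move=> n; have [[U [BU <-]]|h] := pselect (exists U, B U /\ g U = n).
  by rewrite bE//; exact: polish_sub_small_sets (pB _ BU).
exists (fun _ _ => True); have -> : b n = set0.
  by apply/seteqP; split=> // x [U hU _]; apply: h; exists U.
by split=> // F _ /(_ 0%N)[x []].
Qed.

(** Each basic set has its own notion of smallness; order [n] imposes those of the basic sets of
    index at most [n] that contain [A]. This is a finite number of conditions, so each point still
    has small neighbourhoods. *)
Lemma locally_polish_limit_sets (T : topologicalType) (b : nat -> set T) :
  enum_basis b -> (forall n, exists sm, small_sets (b n) sm) ->
  exists sm, limit_sets b sm.
Proof.
move=> bP /choice[sm smP].
exists (fun n A => forall i, (i <= n)%N -> A `<=` b i -> sm i n A); split.
- move=> k x U oU Ux.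
  suff [W [oW Wx hW]] : exists W, [/\ open W, W x & forall i j, (i < k.+1)%N ->
      (j <= k)%N -> forall A, A x -> A `<=` W -> A `<=` b i -> sm i j A].
    exists (U `&` W); split; [exact: openI|by []|exact: subIsetl|].
    move=> j A jk Ax; rewrite subsetI => -[_ AW] i ij Ai.
    by apply: (hW i j) => //; rewrite ltnS (leq_trans ij).
  elim: k.+1 => [|m [W [oW Wx hW]]]; first by exists setT; split=> //; exact: openT.
  have [bmx|nbm] := pselect (b m x).
    have [smS sm_ex _] := smP m.
    have [V [oV Vx _ sV]] := sm_ex k x setT openT I bmx.
    exists (W `&` V); split=> //; first exact: openI.
    move=> i j; rewrite ltnS leq_eqVlt => /orP[/eqP ->|im] jk A Ax; rewrite subsetI => -[AW AV].
      by move=> _; apply: smS sV.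
    exact: hW.
  exists W; split=> // i j; rewrite ltnS leq_eqVlt => /orP[/eqP ->|im] jk A Ax AW; last exact: hW.
  by move=> /(_ _ Ax).
- move=> F Fd F0 sF i n0 Fi.
  have Fm m n : F (m + n)%N `<=` F n.
    elim: m => [|m IH]; first by [].
    by rewrite addSn; apply: subset_trans IH; exact: Fd.
  have Fib n : F (n + (i + n0))%N `<=` b i by rewrite addnA; apply: subset_trans Fi.
  have [smS _ sm_lim] := smP i.
  (* Beyond [n0] the sets lie in [b i], and beyond [i] their smallness takes [b i] into account. *)
  have [|||l bl hl] := sm_lim (fun n => F (n + (i + n0))%N).
  + by move=> n; exact: Fd.
  + by move=> n; have [x Fx] := F0 (n + (i + n0))%N; exists x; split=> //; exact: (Fib n).
  + move=> n; have h := sF (n + (i + n0))%N.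
    have ni : (i <= n + (i + n0))%N by rewrite addnCA leq_addr.
    exact: smS (leq_addr _ _) (@subset_refl _ _) (h i ni (Fib n)).
  + exists l => // U oU Ul; have [n hn] := hl U oU Ul; exists (n + (i + n0))%N => x Fx.
    by apply: hn; split=> //; exact: (Fib n).
Qed.

(** * Topology of a Polish groupoid and of its orbits *)

Section polish_groupoids.
Variables (R : realType) (Obj Arr : topologicalType) (G : groupoid Obj Arr).
Hypothesis polishG : polish_groupoid R G.

Local Notation src := (src G).
Local Notation rng := (rng G).

Lemma gcomp_nbhs g h (W : set Arr) : src g = rng h -> open W -> W (gcomp G g h) ->
  exists U V : set Arr, [/\ open U, open V, U g, V h &
    forall g' h', U g' -> V h' -> src g' = rng h' -> W (gcomp G g' h')].
Proof.
move=> gh oW Wgh.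
pose p : composable G := exist _ (g, h) (mem_set (gh : composable G (g, h))).
have [P oP eP] := (continuousP _).1 (pg_comp_continuous polishG) _ oW.
have Pp : P (g, h).
  by change ((set_val @^-1` P) p); rewrite eP.
have [[U V] [/= nU nV] hUV] : nbhs (g, h) P by exact: open_nbhs_nbhs.
exists (interior U), (interior V); split; rewrite ?[_ g]nbhs_interior//; try exact: open_interior.
move=> g' h' /interior_subset Ug /interior_subset Vh e.
pose q : composable G := exist _ (g', h') (mem_set (e : composable G (g', h'))).
have : (set_val @^-1` P) q by exact: hUV.
by rewrite eP.
Qed.

Lemma idn_continuous : continuous (idn G).
Proof.
by apply/continuousP => A oA; apply/(pg_objects polishG).2; exists A.
Qed.

(** [Obj] carries the topology of the identity arrows, and the identity at [src g] is the product of
    [ginv G g] and [g]; continuity of [src] thus comes from that of the operations. *)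
Lemma src_preimage_open (U : set Obj) : open U -> open (src @^-1` U).
Proof.
move=> /(pg_objects polishG).2 [V oV UV].
rewrite openE => g /= Ug.
have e : src (ginv G g) = rng g by rewrite src_inv.
have Vg : V (gcomp G (ginv G g) g).
  by rewrite comp_invl; move: Ug; rewrite UV.
have [A [B [oA oB Ag Bg h]]] := gcomp_nbhs e oV Vg.
have oA' := (continuousP _).1 (pg_inv_continuous polishG) _ oA.
apply: (@filterS _ _ _ (B `&` ginv G @^-1` A)).
  move=> g' [Bg' Ag'] /=; rewrite UV /= -comp_invl; apply: h => //.
  by rewrite src_inv.
by apply: open_nbhs_nbhs; split=> //; exact: openI.
Qed.

Lemma src_continuous : continuous src.
Proof. by apply/continuousP; exact: src_preimage_open. Qed.

Lemma rng_continuous : continuous rng.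
Proof.
apply/continuousP => U oU; rewrite (_ : _ @^-1` _ = ginv G @^-1` (src @^-1` U)).
  exact: (continuousP _).1 (pg_inv_continuous polishG) _ (src_preimage_open oU).
by apply/seteqP; split=> g /=; rewrite src_inv.
Qed.

(* [src @` W] is the set of objects whose identity lies in W^-1 W. *)
Lemma src_open : open_map src.
Proof.
move=> W oW.
pose O : set (composable G) := set_val @^-1` ((ginv G @` W) `*` W).
have oO : open O.
  by exists ((ginv G @` W) `*` W) => //; apply: open_setX => //; exact: (pg_inv_open polishG).
rewrite (_ : src @` W = idn G @^-1` (composition (G := G) @` O)).
  exact: (continuousP _).1 idn_continuous _ (pg_comp_open polishG oO).
apply/seteqP; split=> [_ [g Wg <-]|x [p]].
  have e : composable G (ginv G g, g) by rewrite /composable /= src_inv.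
  exists (exist _ (ginv G g, g) (mem_set e)).
    by split=> //=; exists g.
  by rewrite /composition /= comp_invl.
case: p => -[k h] kh [/= [g Wg gk] Wh]; rewrite /composition /= => e.
have {}kh : src k = rng h by move: kh; rewrite inE.
exists h => //; have := src_comp kh; rewrite -/(gcomp G) => <-.
by rewrite [X in src X]e src_idn.
Qed.

Lemma rng_open : open_map rng.
Proof.
move=> W oW; rewrite (_ : _ @` _ = src @` (ginv G @` W)).
  by apply: src_open; exact: (pg_inv_open polishG).
apply/seteqP; split=> [_ [g Wg <-]|_ [_ [g Wg <-] <-]].
  by exists (ginv G g); [exists g|rewrite src_inv].
by exists g => //; rewrite src_inv.
Qed.

Definition saturation (U : set Obj) : set Obj := src @` (rng @^-1` U).

Lemma saturation_open U : open U -> open (saturation U).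
Proof.
by move=> oU; apply: src_open; exact: (continuousP _).1 rng_continuous _ oU.
Qed.

Lemma orbit_equivP x y : orbit_equiv G x y <-> exists g, src g = x /\ rng g = y.
Proof. by split=> [[g [r s]]|[g [s r]]]; exists g. Qed.

Lemma orbit_equiv_refl x : orbit_equiv G x x.
Proof. by apply/orbit_equivP; exists (idn G x); rewrite src_idn rng_idn. Qed.

Lemma orbit_equiv_sym x y : orbit_equiv G x y -> orbit_equiv G y x.
Proof.
move=> /orbit_equivP[g [s r]]; apply/orbit_equivP; exists (ginv G g).
by rewrite src_inv rng_inv.
Qed.

Lemma orbit_equiv_trans x y z :
  orbit_equiv G x y -> orbit_equiv G y z -> orbit_equiv G x z.
Proof.
move=> /orbit_equivP[g [gx gy]] /orbit_equivP[h [hy hz]]; apply/orbit_equivP.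
by exists (gcomp G h g); rewrite src_comp ?rng_comp ?hy ?gy.
Qed.

Lemma orbit_equiv_srcrng g : orbit_equiv G (src g) (rng g).
Proof. by apply/orbit_equivP; exists g. Qed.

Definition orbit_invariant (C : set Obj) := forall x y, orbit_equiv G x y -> C x -> C y.

Lemma saturationP U x : saturation U x <-> exists2 y, U y & orbit_equiv G x y.
Proof.
split=> [[g Ug <-]|[y Uy /orbit_equivP[g [<- gy]]]].
  by exists (rng g) => //; exact: orbit_equiv_srcrng.
by exists g => //=; rewrite gy.
Qed.

(** A neighbourhood of [y] has a saturation that is a neighbourhood of [x], hence meets [C];
    invariance brings the meeting point back near [y]. *)
Lemma invariant_closure C : orbit_invariant C -> orbit_invariant (closure C).
Proof.
move=> iC x y xy cx V; rewrite nbhsE => -[W [oW Wy] WV].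
have [|z [Cz /saturationP[w Ww zw]]] := cx (saturation W).
  apply: open_nbhs_nbhs; split; first exact: saturation_open.
  by apply/saturationP; exists y.
by exists w; split; [exact: iC Cz|exact: WV].
Qed.

Lemma invariant_orbit x : orbit_invariant (orbit_of G x).
Proof. by move=> y z yz xy; exact: orbit_equiv_trans yz. Qed.

Lemma fiber_baire x : baire (src @^-1` [set x]).
Proof.
have [sm smP] := polish_sub_small_sets (pg_polish_src polishG x).
exact: small_sets_baire smP.
Qed.

(* The Vaught transform of the dense Gdelta set [\bigcap_n A n]: the points from
   which almost every arrow into U ends in it.  It is an invariant Gdelta set. *)
Lemma comeager_orbit_Gdelta (b : nat -> set Arr) (C U : set Obj)
    (A : nat -> set Obj) (x : Obj) :
  enum_basis b -> closed C -> orbit_invariant C -> open U -> U `&` C !=set0 ->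
  (forall n, open (A n)) ->
  (forall n W, open W -> W `<=` U -> W `&` C !=set0 -> W `&` A n `&` C !=set0) ->
  (forall y, U y -> C y -> (forall n, A n y) -> orbit_equiv G x y) ->
  Gdelta (orbit_of G x).
Proof.
move=> bP cC iC oU UC oA dA hA.
have pO := pg_polish_objects polishG.
have iCr g : C (src g) <-> C (rng g).
  by split; apply: iC; [|apply: orbit_equiv_sym]; exact: orbit_equiv_srcrng.
have orng V : open V -> open (rng @^-1` V).
  by move=> oV; exact: (continuousP _).1 rng_continuous _ oV.
have osrc V : open V -> open (src @^-1` V).
  by move=> oV; exact: (continuousP _).1 src_continuous _ oV.
pose P n i := src @` (b i `&` rng @^-1` (U `&` A n)).
pose Q i := src @` (b i `&` rng @^-1` U).
have oP n i : open (P n i).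
  by apply: src_open; apply: openI; [exact: bP.1|apply: orng; exact: openI].
have oQ i : open (Q i).
  by apply: src_open; apply: openI; [exact: bP.1|exact: orng].
(* For [y] in [C] with some arrow into [U], the last condition says that among the arrows from [y]
   into [U] those ending in [A n] are dense. It is tested on basic sets, which makes it Gdelta. *)
pose V := C `&` saturation U `&` \bigcap_n \bigcap_i (~` Q i `|` P n i).
have GV : Gdelta V.
  apply: GdeltaI.
    apply: GdeltaI; first exact: polish_closed_Gdelta pO cC.
    exact/open_Gdelta/saturation_open.
  apply: Gdelta_bigcap => n; apply: Gdelta_bigcap => i; apply: GdeltaU_open => //.
  exact/(polish_closed_Gdelta pO)/open_closedC.
have VO : V `<=` orbit_of G x.
  move=> y [[Cy [g Ug gy]] hy].
  have [|||h [hy' Uh Ah]] :=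
    baire_local (A := fun n => rng @^-1` A n) (@fiber_baire y) (orng _ oU).
  - by exists g.
  - by move=> n; exact: orng.
  - move=> n W oW WU [h [Wh hy']].
    have [i bh bW] := bP.2 _ _ oW Wh.
    have [[]|[k [bk [Uk Ak]] ky]] := hy n I i I.
      by exists h => //; split=> //; exact: WU.
    by exists k; split=> //; split=> //; exact: bW.
  apply: orbit_equiv_trans (hA (rng h) _ _ _) _ => //.
    by apply/iCr; rewrite hy'.
  by rewrite -hy'; apply: orbit_equiv_sym; exact: orbit_equiv_srcrng.
have iV : orbit_invariant V.
  move=> y z /orbit_equivP[k [ky kz]] [[Cy Uy] hy].
  have yz : orbit_equiv G y z by apply/orbit_equivP; exists k.
  split.
    split; first exact: iC Cy.
    have /saturationP[w Uw yw] := Uy; apply/saturationP; exists w => //.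
    exact: orbit_equiv_trans (orbit_equiv_sym yz) yw.
  move=> n _ i _; have [[h [bh Uh] hz]|nQ] := pselect (Q i z); last by left.
  right.
  (* Composing with [k] turns arrows from [z] into arrows from [y]. Some basic neighbourhood of the
     product of [h] and [k] is sent back into [b i] by the inverse of [k], so density at [y] gives
     density at [z]. *)
  have hk : src h = rng k by rewrite hz kz.
  have hkk : src (gcomp G h k) = rng (ginv G k) by rewrite src_comp// rng_inv.
  have hkkh : gcomp G (gcomp G h k) (ginv G k) = h.
    by rewrite -Defs.compA ?rng_inv// comp_invr -hk comp_idr.
  have bhk : b i (gcomp G (gcomp G h k) (ginv G k)) by rewrite hkkh.
  have [M [N [oM oN Mhk Nk hMN]]] := gcomp_nbhs hkk (bP.1 i) bhk.
  have [j bj jM] := bP.2 _ _ oM Mhk.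
  have [[]|[g [bg [Ug Ag]] gy]] := hy n I j I.
    by exists (gcomp G h k); [split=> //=; rewrite rng_comp|rewrite src_comp].
  have gk : src g = rng (ginv G k) by rewrite rng_inv gy.
  exists (gcomp G g (ginv G k)); last by rewrite src_comp// src_inv.
  by split; [apply: hMN => //; exact: jM|rewrite /= rng_comp].
suff [y Vy] : V !=set0.
  rewrite (_ : orbit_of G x = V) //; apply/seteqP; split=> // z xz.
  apply: (iV y) => //; apply: orbit_equiv_trans xz; apply: orbit_equiv_sym.
  exact: (VO _ Vy).
(* Nonemptiness of [V] is a category argument in [C]: adding the exterior of the trace of [Q i]
   makes each defining condition dense. *)
pose D k := if unpickle k is Some (n, i) then P n i `|` ~` closure (Q i `&` C) else setT.
have [||k|k|y [Cy Uy Dy]] := @polish_closed_baire _ _ _ pO cC (saturation U) D.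
- exact: saturation_open.
- have [y [Uy Cy]] := UC; exists y; split=> //; apply/saturationP; exists y => //.
  exact: orbit_equiv_refl.
- rewrite /D; case: unpickle => [[n i]|]; last exact: openT.
  by apply: openU => //; exact/closed_openC/closed_closure.
- rewrite /D; case: unpickle => [[n i]|]; last by move=> W _; rewrite setIT.
  move=> W oW [z [Wz Cz]].
  have [cz|ncz] := pselect (closure (Q i `&` C) z); last first.
    by exists z; split=> //; split=> //; right.
  have [_ [[[h [bh Uh] <-] Ch] Wh]] := cz W (open_nbhs_nbhs (conj oW Wz)).
  (* As [rng] is open, the ends of these arrows form an open subset of [U], on which [A n] is
     dense. *)
  have [||| _ [[[g [[bg Wg] Ug] <-] Ag] Cg]] :=
    dA n (rng @` (b i `&` src @^-1` W `&` rng @^-1` U)).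
  + by apply: rng_open; apply: openI; [apply: openI; [exact: bP.1|exact: osrc]|exact: orng].
  + by move=> _ [g [_ Ug] <-].
  + by exists (rng h); split; [exists h|apply/iCr].
  exists (src g); split; last exact/iCr.
  by split=> //; left; exists g.
exists y; split=> // n _ i _.
have [Qy|] := pselect (Q i y); last by left.
right; have := Dy (pickle (n, i)); rewrite /D pickleK => -[//|].
by case; apply: subset_closure.
Qed.

(** Baire gives an open [W] whose trace on the closure lies in the orbit; the saturation of [W] then
    covers the orbit and meets the closure in nothing else. *)
Lemma Gdelta_orbit_open_in_closure (x : Obj) :
  Gdelta (orbit_of G x) -> Fsigma (orbit_of G x) -> open_in_closure (orbit_of G x).
Proof.
move=> gO fO; set O := orbit_of G x.
have xO : O x by exact: orbit_equiv_refl.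
have cO : baire (closure O).
  exact/(polish_closed_baire (pg_polish_objects polishG))/closed_closure.
have [||W [oW [z [Wz cz]] WO]] := Gdelta_Fsigma_interior cO _ (@subset_closure _ O) _ gO fO.
- by exists x.
- by [].
exists (saturation W); first exact: saturation_open.
apply/seteqP; split=> [y Oy|y [/saturationP[w Ww yw] cy]].
  split; last exact: subset_closure.
  apply/saturationP; exists z => //.
  by apply: orbit_equiv_trans (orbit_equiv_sym Oy) _; exact: WO.
have Ow : O w.
  by apply: WO; split=> //; exact: (invariant_closure (@invariant_orbit x)) yw cy.
exact: orbit_equiv_trans Ow (orbit_equiv_sym yw).
Qed.

Lemma nonGdelta_orbit_meager (x : Obj) :
  (forall y, Gdelta (orbit_of G y) -> Fsigma (orbit_of G y)) ->
  ~ Gdelta (orbit_of G x) ->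
  let C := closure (orbit_of G x) in
  meager_in (C `*` C) [set p | orbit_equiv G p.1 p.2].
Proof.
move=> GF nG C; apply: contrapT => nm; apply: nG.
have pO := pg_polish_objects polishG.
have cC : closed C by exact: closed_closure.
have iC : orbit_invariant C := invariant_closure (@invariant_orbit x).
have bC : baire C := polish_closed_baire pO cC.
have [b bP] := polish_basis pO; have [b2 b2P] := enum_basis_prod bP bP.
have [c [cP cs]] := locally_polish_basis (pg_locally_polish polishG).
have [sm smP] := locally_polish_limit_sets cP cs.
have hO := polish_hausdorff pO.
pose f g := (rng g, src g).
have cf : continuous f.
  by move=> g; apply: cvg_pair; [exact: rng_continuous|exact: src_continuous].
have fE : range f = [set p | orbit_equiv G p.1 p.2].
  apply/seteqP; split=> [_ [g _ <-]|[y z] /= /orbit_equiv_sym/orbit_equivP[g [gz gy]]].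
    exact/orbit_equiv_sym/orbit_equiv_srcrng.
  by exists g => //; rewrite /f gz gy.
have [|V [A [oV VC oA dA hA]]] :=
    @nonmeager_image _ _ f c sm b2 (C `*` C) smP cP b2P cf (hausdorff_prod hO hO).
  by rewrite fE.
have [U [z [Cz oU UC UV dU]]] := comeager_section bP bC oV VC oA dA.
have oAz n : open [set y | A n (y, z)].
  rewrite openE => y Ay; have [[M N] [/= nM nN] hMN] : nbhs (y, z) (A n) by exact: open_nbhs_nbhs.
  by apply: filterS nM => y' My'; apply: hMN; split=> //; exact: nbhs_singleton.
have Uz y : U y -> C y -> (forall n, A n (y, z)) -> orbit_equiv G z y.
  move=> Uy Cy Ay; apply: orbit_equiv_sym.
  by have := hA (y, z) (UV _ Uy) (conj Cy Cz) Ay; rewrite fE.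
have gz : Gdelta (orbit_of G z).
  exact: comeager_orbit_Gdelta cP cC iC oU UC oAz dU Uz.
have zC : orbit_of G z `<=` C by move=> y zy; exact: iC zy Cz.
have xC W : open W -> W `&` C !=set0 -> exists2 y, orbit_of G x y & W y.
  move=> oW [y [Wy cy]].
  by have [y' [xy' Wy']] := cy W (open_nbhs_nbhs (conj oW Wy)); exists y'.
(* So far the orbit of [z] is only known to be comeager inside [U]. The dense orbit of [x] visits
   both [U] and any [W] meeting [C], so the points of [U] equivalent to a point of [W] form a
   nonempty relatively open set, which the orbit of [z] must meet. *)
have Cz' : C `<=` closure (orbit_of G z).
  move=> y Cy N; rewrite nbhsE => -[W [oW Wy] WN].
  have [w xw Ww] := xC W oW (ex_intro _ y (conj Wy Cy)).
  have [u xu Uu] := xC U oU UC.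
  have uW : saturation W u.
    by apply/saturationP; exists w => //; apply: orbit_equiv_trans xw; exact: orbit_equiv_sym.
  have [||||y' [Cy' [Uy' /saturationP[w' Ww' y'w']] Ay']] :=
      baire_local (U := U `&` saturation W) (A := fun n => [set y | A n (y, z)]) bC.
  - by apply: openI => //; exact: saturation_open.
  - by exists u; split=> //; exact: subset_closure.
  - by [].
  - move=> n W' oW' W'U; apply: dU => //; apply: subset_trans W'U _; exact: subIsetl.
  exists w'; split; last exact: WN.
  exact: orbit_equiv_trans (Uz _ Uy' Cy' Ay') y'w'.
have [|W [oW WC Wz]] := Gdelta_Fsigma_interior bC _ zC Cz' gz (GF _ gz).
  by exists z; exact: orbit_equiv_refl.
have [w xw Ww] := xC W oW WC.
have zx : orbit_equiv G z x.
  apply: orbit_equiv_trans (orbit_equiv_sym xw).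
  by apply: Wz; split=> //; exact: subset_closure.
rewrite (_ : orbit_of G x = orbit_of G z) //; apply/seteqP; split=> y xy.
  exact: orbit_equiv_trans zx xy.
by apply: orbit_equiv_trans xy; exact: orbit_equiv_sym.
Qed.

End polish_groupoids.

(** * Embedding E0 *)

Lemma open_preimage (S T : topologicalType) (f : S -> T) U :
  continuous f -> open U -> open (f @^-1` U).
Proof. by move/continuousP; apply. Qed.

(** * Finite approximations of an embedding and their refinement *)

Section approximations.
Variables (R : realType) (Obj Arr : topologicalType) (G : groupoid Obj Arr).
Hypothesis polishG : polish_groupoid R G.
Variable C : set Obj.
Hypothesis iC : orbit_invariant G C.

Local Notation src := (src G).
Local Notation rng := (rng G).

(* A finite approximation of an embedding of E0: a point of Obj for every binary
   word of length m, and arrows connecting them along a spanning tree.  The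
   words of length m.+1 ending in 0 and in 1 form two approximations of length m,
   joined by an arrow between their base points, at the null words. *)
Fixpoint approx (m : nat) : topologicalType :=
  if m is m'.+1 then (approx m' * approx m' * Arr)%type else Obj.

Fixpoint pt (m : nat) (a : nat -> bool) : approx m -> Obj :=
  match m with
  | 0 => id
  | m'.+1 => fun q => pt a (if a m' then q.1.2 else q.1.1)
  end.

Fixpoint edge (m k : nat) (a : nat -> bool) : approx m -> Arr :=
  match m with
  | 0 => idn G
  | m'.+1 => fun q =>
      if k == m' then q.2 else edge k a (if a m' then q.1.2 else q.1.1)
  end.

Definition null_word : nat -> bool := fun=> false.

Definition base m : approx m -> Obj := pt null_word.

Fixpoint valid (m : nat) : set (approx m) :=
  match m with
  | 0 => C
  | m'.+1 => [set q | [/\ valid q.1.1, valid q.1.2,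
      src q.2 = base q.1.1 & rng q.2 = base q.1.2]]
  end.

Lemma pt_ext m (a a' : nat -> bool) : (forall i, (i < m)%N -> a i = a' i) ->
  @pt m a = pt a'.
Proof.
elim: m => [//|m IH] h; apply/funext => q /=; rewrite h// IH// => i im.
by apply: h; exact: ltnW.
Qed.

Lemma edge_ext m k (a a' : nat -> bool) :
  (forall i, (k < i < m)%N -> a i = a' i) -> (k < m)%N -> @edge m k a = edge k a'.
Proof.
elim: m => [//|m IH] h km; apply/funext => q /=; case: eqP => [//|/eqP kNm].
have {}km : (k < m)%N by rewrite ltn_neqAle kNm -ltnS.
rewrite h ?km ?leqnn// IH// => i /andP[ki im].
by apply: h; rewrite ki ltnW.
Qed.

Lemma valid_pt m a (q : approx m) : valid q -> C (pt a q).
Proof. by elim: m q => [//|m IH] q /= [v1 v2 _ _]; case: (a m); exact: IH. Qed.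

(* The end points of the k-th arrow: the bits above k are those of a, the bits
   below k are null. *)
Definition cut (k : nat) (c : bool) (a : nat -> bool) : nat -> bool :=
  fun i => if (i < k)%N then false else if i == k then c else a i.

Lemma valid_edge m k a (q : approx m) : valid q -> (k < m)%N ->
  src (edge k a q) = pt (cut k false a) q /\ rng (edge k a q) = pt (cut k true a) q.
Proof.
elim: m q => [//|m IH] q /= [v1 v2 sq rq] km; case: eqP => [->|/eqP kNm].
  rewrite sq rq /base /cut ltnn eqxx; split; congr (_ _); apply: pt_ext => i im.
    by rewrite im.
  by rewrite im.
have {}km : (k < m)%N by rewrite ltn_neqAle kNm -ltnS.
have e c : cut k c a m = a m by rewrite /cut ltnNge (ltnW km) /= eq_sym (negbTE kNm).
rewrite !e.
by case: (a m); exact: IH.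
Qed.

Lemma pt_continuous m a : continuous (@pt m a).
Proof.
elim: m => [|m IH] /=; first by move=> x; exact: cvg_id.
move=> q; apply: (@continuous_comp _ _ _ (fun q : approx m.+1 => if a m then q.1.2 else q.1.1)).
  case: (a m).
    apply: (@continuous_comp _ _ _ fst snd); [exact: cvg_fst|exact: cvg_snd].
  by apply: (@continuous_comp _ _ _ fst fst); exact: cvg_fst.
exact: IH.
Qed.

Lemma edge_continuous m k a : (k < m)%N -> continuous (@edge m k a).
Proof.
elim: m => [//|m IH] km /=; case: eqP => [_|/eqP kNm] q; first exact: cvg_snd.
apply: (@continuous_comp _ _ _ (fun q : approx m.+1 => if a m then q.1.2 else q.1.1)).
  case: (a m).
    apply: (@continuous_comp _ _ _ fst snd); [exact: cvg_fst|exact: cvg_snd].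
  by apply: (@continuous_comp _ _ _ fst fst); exact: cvg_fst.
by apply: IH; rewrite ltn_neqAle kNm -ltnS.
Qed.

(** The half containing the point is moved by induction, under the extra demand that its new base
    point be the end of an arrow close to the old connecting one. That arrow starts or ends near the
    old base point of the other half, which is moved by induction too. The demand is an open
    condition since [src] and [rng] are open maps. *)
Lemma pt_open m a (Q : set (approx m)) (q : approx m) : open Q -> Q q -> valid q ->
  exists N, [/\ open N, N (pt a q) &
    forall y, N y -> C y -> exists q', [/\ Q q', valid q' & pt a q' = y]].
Proof.
elim: m a Q q => [|m IH] a Q q oQ Qq vq.
  by exists Q; split=> // y Qy Cy; exists y.
case: q Qq vq => -[q1 q2] h Qq [/= v1 v2 sh rh].
have [[P3 H] [/= nP3 nH] PHQ] : nbhs (q1, q2, h) Q by exact: open_nbhs_nbhs.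
have [[P1 P2] [/= nP1 nP2] P12] := nP3.
move: nP1 nP2 nH; rewrite !nbhsE.
move=> [Q1 [oQ1 Qq1] QP1] [Q2 [oQ2 Qq2] QP2] [K [oK Kh] KH].
have inQ r1 r2 g : Q1 r1 -> Q2 r2 -> K g -> Q (r1, r2, g).
  by move=> x1 x2 x3; apply: PHQ; split; [apply: P12; split; [exact: QP1|exact: QP2]|exact: KH].
have iCh g : C (src g) <-> C (rng g).
  by split; apply: iC; [|apply: orbit_equiv_sym]; exact: orbit_equiv_srcrng.
rewrite /=; case: (a m).
  have [N1 [oN1 Nq1 hN1]] := IH null_word Q1 q1 oQ1 Qq1 v1.
  have oL : open (rng @` (K `&` src @^-1` N1)).
    apply: (rng_open polishG); apply: openI => //.
    exact: open_preimage (src_continuous polishG) oN1.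
  have [|||N [oN Nq2 hN]] := IH a (Q2 `&` @base m @^-1` (rng @` (K `&` src @^-1` N1))) q2.
  - by apply: openI => //; apply: open_preimage oL; exact: pt_continuous.
  - by split=> //=; exists h; rewrite -?rh//; split=> //; rewrite /= sh.
  - by [].
  exists N; split=> // y Ny Cy.
  have [r2 [[Qr2 /= [g [Kg Ng] gr]] vr2 ry]] := hN _ Ny Cy.
  have [|r1 [Qr1 vr1 gr1]] := hN1 _ Ng.
    by apply/iCh; rewrite gr; exact: valid_pt.
  by exists (r1, r2, g); split; [exact: inQ|split|].
have [N2 [oN2 Nq2 hN2]] := IH null_word Q2 q2 oQ2 Qq2 v2.
have oL : open (src @` (K `&` rng @^-1` N2)).
  apply: (src_open polishG); apply: openI => //.
  exact: open_preimage (rng_continuous polishG) oN2.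
have [|||N [oN Nq1 hN]] := IH a (Q1 `&` @base m @^-1` (src @` (K `&` rng @^-1` N2))) q1.
- by apply: openI => //; apply: open_preimage oL; exact: pt_continuous.
- by split=> //=; exists h; rewrite -?sh//; split=> //; rewrite /= rh.
- by [].
exists N; split=> // y Ny Cy.
have [r1 [[Qr1 /= [g [Kg Ng] gr]] vr1 ry]] := hN _ Ny Cy.
have [|r2 [Qr2 vr2 gr2]] := hN2 _ Ng.
  by apply/iCh; rewrite gr; exact: valid_pt.
by exists (r1, r2, g); split; [exact: inQ|split|].
Qed.

Definition word m (s : m.-tuple bool) : nat -> bool := nth false s.

Lemma word_mktuple m (a : nat -> bool) i : (i < m)%N ->
  word [tuple a j | j < m] i = a i.
Proof. by move=> im; rewrite /word (nth_mktuple _ _ (Ordinal im)). Qed.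

Lemma pt_word m a : @pt m a = pt (word [tuple a j | j < m]).
Proof. by apply: pt_ext => i im; rewrite word_mktuple. Qed.

Lemma edge_word m k a : (k < m)%N ->
  @edge m k a = edge k (word [tuple a j | j < m]).
Proof. by apply: edge_ext => i /andP[_ im]; rewrite word_mktuple. Qed.

(** Two copies of [Q] are shrunk once for each of the finitely many pairs of words, each time
    forcing that pair of points into [W]. Finally both base points are moved into the dense orbit,
    so that an arrow can join them. *)
Lemma generic_pair m (Q : set (approx m)) (W : set (Obj * Obj)) (x : Obj) :
  open Q -> Q `&` valid (m := m) !=set0 -> open W -> dense_in (C `*` C) W ->
  C `<=` closure (orbit_of G x) -> orbit_of G x `<=` C ->
  exists q q' : approx m, [/\ Q q /\ Q q', valid q /\ valid q',
    orbit_equiv G (base q) (base q') &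
    forall s t : m.-tuple bool, W (pt (word s) q, pt (word t) q')].
Proof.
move=> oQ [q0 [Qq0 vq0]] oW dW Cx xC.
suff [Q1 [Q2 [[oQ1 Q1Q [q1 [Qq1 v1]]] [oQ2 Q2Q [q2 [Qq2 v2]]] hW]]] :
    exists Q1 Q2 : set (approx m), [/\
      [/\ open Q1, Q1 `<=` Q & Q1 `&` valid (m := m) !=set0],
      [/\ open Q2, Q2 `<=` Q & Q2 `&` valid (m := m) !=set0] &
      forall st, st \in enum [set: m.-tuple bool * m.-tuple bool] ->
      forall r1 r2, Q1 r1 -> Q2 r2 -> W (pt (word st.1) r1, pt (word st.2) r2)].
  have orb Q' q' : open Q' -> Q' q' -> valid q' ->
      exists r, [/\ Q' r, valid r & orbit_equiv G x (base r)].
    move=> oQ' Qq' vq'; have [N [oN Nq' hN]] := pt_open null_word oQ' Qq' vq'.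
    have [y [xy Ny]] := Cx _ (valid_pt null_word vq') N (open_nbhs_nbhs (conj oN Nq')).
    have [r [Qr vr ry]] := hN y Ny (xC _ xy).
    by exists r; split=> //; rewrite /base ry.
  have [r1 [Qr1 vr1 xr1]] := orb _ _ _ oQ1 Qq1 v1.
  have [r2 [Qr2 vr2 xr2]] := orb _ _ _ oQ2 Qq2 v2.
  exists r1, r2; split=> //; first by split; [exact: Q1Q|exact: Q2Q].
    exact: orbit_equiv_trans (orbit_equiv_sym xr1) xr2.
  by move=> s t; apply: (hW (s, t)) => //; rewrite mem_enum inE.
elim: (enum _) => [|[s t] L [Q1 [Q2 [[oQ1 Q1Q [q1 [Qq1 v1]]] [oQ2 Q2Q [q2 [Qq2 v2]]] hW]]]].
  by exists Q, Q; split=> //; split=> //; exists q0.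
have [N1 [oN1 Nq1 hN1]] := pt_open (word s) oQ1 Qq1 v1.
have [N2 [oN2 Nq2 hN2]] := pt_open (word t) oQ2 Qq2 v2.
have [||[y1 y2] [[[/= Ny1 Ny2] Wy] [/= Cy1 Cy2]]] := dW (N1 `*` N2).
- exact: open_setX.
- by exists (pt (word s) q1, pt (word t) q2); split=> //; split; exact: valid_pt.
have [r1 [Qr1 vr1 ry1]] := hN1 _ Ny1 Cy1.
have [r2 [Qr2 vr2 ry2]] := hN2 _ Ny2 Cy2.
have [[W1 W2] [/= nW1 nW2] W12] : nbhs (y1, y2) W by exact: open_nbhs_nbhs.
move: nW1 nW2; rewrite !nbhsE => -[V1 [oV1 Vy1] VW1] [V2 [oV2 Vy2] VW2].
exists (Q1 `&` pt (word s) @^-1` V1), (Q2 `&` pt (word t) @^-1` V2); split.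
- split; [|by apply: subset_trans Q1Q; exact: subIsetl|by exists r1; rewrite /preimage /= ry1].
  by apply: openI => //; apply: open_preimage oV1; exact: pt_continuous.
- split; [|by apply: subset_trans Q2Q; exact: subIsetl|by exists r2; rewrite /preimage /= ry2].
  by apply: openI => //; apply: open_preimage oV2; exact: pt_continuous.
- move=> st; rewrite inE => /orP[/eqP -> /=|stL] p1 p2 [Qp1 Vp1] [Qp2 Vp2].
    by apply: W12; split; [exact: VW1|exact: VW2].
  exact: hW.
Qed.

Variables (smO : nat -> set (set Obj)) (smA : nat -> set (set Arr)).
Variable b : nat -> set Arr.
Hypothesis smOP : @small_sets Obj setT smO.
Hypothesis bP : enum_basis b.
Hypothesis smAP : limit_sets b smA.

(** Closures keep the limit points in [W]. All orders [j] up to [m] are required because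
    [limit_sets] does not make smallness monotone in the order, and the sequence of sets for the
    [k]-th arrow starts only at stage [k.+1]. The last clause confines each new arrow to one basic
    set, where limits exist and the topology is regular. *)
Definition refines (m : nat) (W : set (Obj * Obj)) (Q : set (approx m))
    (Q' : set (approx m.+1)) :=
  [/\ forall q, Q' q -> Q q.1.1 /\ Q q.1.2,
      forall a, smO m (pt a @` Q'),
      forall a a', a m = false -> a' m = true ->
        closure (pt a @` Q') `*` closure (pt a' @` Q') `<=` W,
      forall j k a, (j <= m)%N -> (k <= m)%N ->
        smA j (edge k a @` (Q' `&` valid (m := m.+1))) &
      exists i, forall q, Q' q -> b i q.2].

Lemma approx_refine (m : nat) (Q : set (approx m)) (W : set (Obj * Obj)) (x : Obj) :
  open Q -> Q `&` valid (m := m) !=set0 -> open W -> dense_in (C `*` C) W ->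
  C `<=` closure (orbit_of G x) -> orbit_of G x `<=` C ->
  exists Q' : set (approx m.+1),
    [/\ open Q', Q' `&` valid (m := m.+1) !=set0 & refines W Q Q'].
Proof.
move=> oQ Qv oW dW Cx xC.
have [q1 [q2 [[Qq1 Qq2] [v1 v2] /orbit_equivP[h [sh rh]] hW]]] :=
  generic_pair oQ Qv oW dW Cx xC.
pose q0 : approx m.+1 := (q1, q2, h).
have v0 : valid q0 by [].
have [smS sm_ex _] := smOP.
(* [V], [V2] and [V3] are neighbourhoods of the points, the pairs of points and the arrows of [q0].
   There are finitely many words, so together they define a neighbourhood [P] of [q0]. *)
have /choice[V hV] : forall s : m.+1.-tuple bool, exists V : set Obj,
    [/\ open V, V (pt (word s) q0) & smO m V].
  move=> s; have [V [oV Vs _ sV]] := sm_ex m (pt (word s) q0) setT openT I I.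
  by exists V.
have /choice[V2 hV2] : forall st : m.+1.-tuple bool * m.+1.-tuple bool,
    exists V : set Obj * set Obj,
    [/\ open V.1 /\ open V.2, V.1 (pt (word st.1) q0) /\ V.2 (pt (word st.2) q0) &
      word st.1 m = false -> word st.2 m = true -> closure V.1 `*` closure V.2 `<=` W].
  move=> [s t].
  have [es|] := pselect (word s m = false /\ word t m = true); last first.
    move=> n; exists (setT, setT); split; [by split; exact: openT|by []|] => es et.
    by exfalso; apply: n.
  have {es}[es et] := es.
  have Wst : W (pt (word s) q0, pt (word t) q0).
    by rewrite /= es et /= (pt_word m (word s)) (pt_word m (word t)); exact: hW.
  have [[U1 U2] [/= nU1 nU2] U12] : nbhs (pt (word s) q0, pt (word t) q0) W.
    exact: open_nbhs_nbhs.
  move: nU1 nU2; rewrite !nbhsE => -[W1 [oW1 W1s] WU1] [W2 [oW2 W2t] WU2].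
  have [V1 [oV1 V1s cV1 _]] := sm_ex 0%N _ W1 oW1 W1s I.
  have [V1' [oV1' V1't cV1' _]] := sm_ex 0%N _ W2 oW2 W2t I.
  exists (V1, V1'); split=> // _ _ [y z] [/= cy cz]; apply: U12; split.
    by apply: WU1; apply: cV1; rewrite !setIT.
  by apply: WU2; apply: cV1'; rewrite !setIT.
have /choice[V3 hV3] : forall ks : 'I_m.+1 * m.+1.-tuple bool, exists V : set Arr,
    [/\ open V, V (edge ks.1 (word ks.2) q0) &
      forall j A, (j <= m)%N -> A (edge ks.1 (word ks.2) q0) -> A `<=` V -> smA j A].
  move=> [k s]; have [V' [oV' V's _ sV']] := smAP.1 m (edge k (word s) q0) setT openT I.
  by exists V'.
have [i bi _] := bP.2 h setT openT I.
pose P : set (approx m.+1) := [set q : approx m.+1 |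
  (Q q.1.1 /\ Q q.1.2) /\ b i q.2 /\
  (forall s, V s (pt (word s) q)) /\
  (forall st, (V2 st).1 (pt (word st.1) q) /\ (V2 st).2 (pt (word st.2) q)) /\
  (forall ks, V3 ks (edge ks.1 (word ks.2) q))].
have nearE (T : topologicalType) (f : approx m.+1 -> T) (U : set T) :
    continuous f -> open U -> U (f q0) -> \forall q \near q0, U (f q).
  move=> cf oU Uf; apply: (@open_nbhs_nbhs _ q0 (f @^-1` U)); split=> //.
  exact: open_preimage.
have nP : nbhs q0 P.
  apply: filterI.
    apply: filterI.
      apply: (nearE _ (fun q : approx m.+1 => q.1.1)) => // q.
      by apply: (@continuous_comp _ _ _ fst fst); exact: cvg_fst.
    apply: (nearE _ (fun q : approx m.+1 => q.1.2)) => // q.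
    by apply: (@continuous_comp _ _ _ fst snd); [exact: cvg_fst|exact: cvg_snd].
  apply: filterI.
    by apply: (nearE _ (fun q : approx m.+1 => q.2)) (bP.1 i) bi => q; exact: cvg_snd.
  apply: filterI.
    apply: (@filter_forall _ _ (fun s (q : approx m.+1) => V s (pt (word s) q))
      (nbhs (q0 : approx m.+1))) => s; have [oV Vs _] := hV s.
    by apply: nearE => //; exact: pt_continuous.
  apply: filterI.
    apply: (@filter_forall _ _ (fun st (q : approx m.+1) => (V2 st).1 (pt (word st.1) q) /\
      (V2 st).2 (pt (word st.2) q)) (nbhs (q0 : approx m.+1))) => st.
    have [[oV oV'] [Vs Vs'] _] := hV2 st.
    by apply: filterI; apply: nearE => //; exact: pt_continuous.
  apply: (@filter_forall _ _ (fun ks (q : approx m.+1) => V3 ks (edge ks.1 (word ks.2) q))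
    (nbhs (q0 : approx m.+1))) => ks; have [oV Vs _] := hV3 ks.
  by apply: nearE => //; exact: edge_continuous.
exists (interior P); split; first exact: open_interior.
  by exists q0.
split.
- by move=> q /interior_subset[].
- move=> a; rewrite pt_word; have [_ _ sV] := hV [tuple a j | j < m.+1].
  apply: smS sV => // _ [q /interior_subset[_ [_ [hs _]]] <-]; exact: hs.
- move=> a a' am a'm; rewrite (pt_word m.+1 a) (pt_word m.+1 a').
  set s := [tuple a j | j < m.+1]; set t := [tuple a' j | j < m.+1].
  have [_ _ h2] := hV2 (s, t).
  apply: subset_trans (h2 _ _); [|by rewrite word_mktuple..].
  apply: setSX; apply: closureS => _ [q /interior_subset[_ [_ [_ [hs _]]]] <-].
    by have [] := hs (s, t).
  by have [] := hs (s, t).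
- move=> j k a jm km; rewrite edge_word//.
  set s := [tuple a j | j < m.+1]; have [_ _ h3] := hV3 (@Ordinal m.+1 k km, s).
  apply: h3 => //; first by exists q0.
  move=> _ [q [/interior_subset[_ [_ [_ [_ hs]]]] _] <-].
  exact: (hs (@Ordinal m.+1 k km, s)).
- by exists i => q /interior_subset[_ []].
Qed.

End approximations.

Definition agree (m : nat) (a a' : nat -> bool) := forall i, (i < m)%N -> a' i = a i.

Lemma agree_sub m n a a' : (m <= n)%N -> agree n a a' -> agree m a a'.
Proof. by move=> mn h i im; apply: h; exact: leq_trans mn. Qed.

Lemma nbhs_agree m (a : cantor_space) : nbhs a [set a' | agree m a a'].
Proof.
elim: m => [|m IH]; first by apply: filterS filterT => a' _ i.
have h : nbhs a [set a' : cantor_space | a' m = a m].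
  exact: (@proj_continuous nat (fun=> bool) m a _ (discrete_set1 (a m))).
apply: filterS (filterI IH h) => a' [/= ha' am] i.
by rewrite ltnS leq_eqVlt => /orP[/eqP ->|]; [|exact: ha'].
Qed.

(** Continuity read on initial segments lets the limit maps be handled on plain functions; the
    topology of [E0_arrow] appears only in [arr_map_continuous]. *)
Definition cyl_continuous (T : topologicalType) (f : (nat -> bool) -> T) :=
  forall a U, open U -> U (f a) -> exists m, forall a', agree m a a' -> U (f a').

(** Erasing the low bits one by one follows a path in the spanning tree. Sequences that agree from
    [n] on have the same [tail n], where their paths meet. *)
Definition tail (n : nat) (a : nat -> bool) : nat -> bool :=
  fun i => if (i < n)%N then false else a i.

Lemma cut_false n a : cut n false a = tail n.+1 a.
Proof.
by apply/funext => i; rewrite /cut /tail ltnS; case: ltngtP.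
Qed.

Lemma cut_true n (a : nat -> bool) : a n -> cut n true (tail n.+1 a) = tail n a.
Proof.
by move=> an; apply/funext => i; rewrite /cut /tail ltnS; case: ltngtP => // ->.
Qed.

Lemma tail_idem n a : tail n (tail n a) = tail n a.
Proof. by apply/funext => i; rewrite /tail; case: (i < n)%N. Qed.

Lemma tailS n (a : nat -> bool) : a n = false -> tail n a = tail n.+1 a.
Proof.
by move=> an; apply/funext => i; rewrite /tail ltnS; case: ltngtP => // ->.
Qed.

Lemma agree_tail n m a a' : agree m a a' -> agree m (tail n a) (tail n a').
Proof. by move=> h i im; rewrite /tail h. Qed.

Lemma finite_nat_bound (A : set nat) : finite_set A ->
  exists n, forall i, (n <= i)%N -> ~ A i.
Proof.
move=> /finite_seqP[X ->]; exists (\max_(i <- X) i).+1 => i Xi /= iX.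
by have := @leq_bigmax_seq _ X xpredT id i iX isT; rewrite leqNgt Xi.
Qed.

Section groupoid_algebra.
Variables (Obj Arr : Type) (G : groupoid Obj Arr).
Local Notation src := (src G).
Local Notation rng := (rng G).

Lemma ginv_unique (g h : Arr) : src g = rng h -> gcomp G g h = idn G (rng g) -> h = ginv G g.
Proof.
move=> gh e; have gi : src (ginv G g) = rng g by rewrite src_inv.
have := Defs.compA gi gh; rewrite e comp_invl gh comp_idl => <-.
by rewrite -src_inv comp_idr.
Qed.

Lemma ginv_comp (g h : Arr) : src g = rng h ->
  ginv G (gcomp G g h) = gcomp G (ginv G h) (ginv G g).
Proof.
move=> gh; have hg : src (ginv G h) = rng (ginv G g) by rewrite src_inv rng_inv.
have ghh : src (gcomp G g h) = rng (ginv G h) by rewrite src_comp// rng_inv.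
apply/esym/ginv_unique; first by rewrite src_comp// rng_comp// rng_inv.
rewrite rng_comp// Defs.compA// -[X in gcomp G X (ginv G g)]Defs.compA ?rng_inv//.
by rewrite comp_invr -gh comp_idr comp_invr.
Qed.

Lemma gcomp_cancel (f g h : Arr) : src f = src g -> src g = src h ->
  gcomp G (gcomp G f (ginv G g)) (gcomp G g (ginv G h)) = gcomp G f (ginv G h).
Proof.
move=> fg gh; have e1 : src f = rng (ginv G g) by rewrite rng_inv.
have e3 : src g = rng (ginv G h) by rewrite rng_inv.
have e2 : src (ginv G g) = rng (gcomp G g (ginv G h)) by rewrite rng_comp// src_inv.
have e4 : src (ginv G g) = rng g by rewrite src_inv.
by rewrite -(Defs.compA e1 e2) (Defs.compA e4 e3) comp_invl e3 comp_idl.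
Qed.

End groupoid_algebra.

(** * The limit of a refining sequence of approximations *)

Section embedding.
Variables (R : realType) (Obj Arr : topologicalType) (G : groupoid Obj Arr).
Hypothesis polishG : polish_groupoid R G.
Variable C : set Obj.
Hypotheses (iC : orbit_invariant G C) (cC : closed C).
Variables (smO : nat -> set (set Obj)) (smA : nat -> set (set Arr)).
Variable b : nat -> set Arr.
Hypothesis smOP : @small_sets Obj setT smO.
Hypothesis bP : enum_basis b.
Hypothesis smAP : limit_sets b smA.
Hypothesis bS : forall n, exists sm, small_sets (b n) sm.
Variables (W : nat -> set (Obj * Obj)) (Q : forall m, set (approx Obj Arr m)).
Arguments Q : clear implicits.
Local Notation valid m := (@valid Obj Arr G C m).
Hypothesis Qv : forall m, Q m `&` valid m !=set0.
Hypothesis QP : forall m, refines G C smO smA b (W m) (Q m) (Q m.+1).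

Local Notation src := (src G).
Local Notation rng := (rng G).

Lemma pt_decreasing a m n : (n <= m)%N ->
  [set pt a q | q in Q m `&` valid m] `<=` [set pt a q | q in Q n `&` valid n].
Proof.
elim: m => [|m IH]; first by rewrite leqn0 => /eqP ->.
rewrite leq_eqVlt => /orP[/eqP -> //|/IH]; apply: subset_trans.
move=> _ [q [Qq [/= v1 v2 _ _]] <-]; have [hQ _ _ _ _] := QP m.
by have [Q1 Q2] := hQ _ Qq; rewrite /=; case: (a m); [exists q.1.2|exists q.1.1].
Qed.

Lemma edge_decreasing k a m n : (k < n <= m)%N ->
  [set edge G k a q | q in Q m `&` valid m] `<=`
  [set edge G k a q | q in Q n `&` valid n].
Proof.
move=> /andP[kn]; elim: m => [|m IH]; first by rewrite leqn0 => /eqP ->.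
rewrite leq_eqVlt => /orP[/eqP -> //|nm]; have := IH nm; apply: subset_trans.
move=> _ [q [Qq [/= v1 v2 _ _]] <-]; have [hQ _ _ _ _] := QP m.
have -> : (k == m) = false by apply/negbTE; rewrite neq_ltn (leq_trans kn).
by have [Q1 Q2] := hQ _ Qq; case: (a m); [exists q.1.2|exists q.1.1].
Qed.

Lemma pt_limit a : exists l, forall U, open U -> U l ->
  exists m, [set pt a q | q in Q m `&` valid m] `<=` U.
Proof.
have [smS _ sm_lim] := smOP.
have [|||l _ hl] := sm_lim (fun n => [set pt a q | q in Q n.+1 `&` valid n.+1]).
- by move=> n; exact: pt_decreasing.
- by move=> n; have [q Qq] := Qv n.+1; exists (pt a q); split=> //; exists q.
- move=> n; have [_ h _ _ _] := QP n; apply: smS (h a) => //.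
  by apply: image_subset; exact: subIsetl.
exists l => U oU Ul; have [n hn] := hl U oU Ul.
by exists n.+1; move: hn; rewrite setIT.
Qed.

Definition obj_map a : Obj := projT1 (cid (pt_limit a)).

Lemma obj_map_near a U : open U -> U (obj_map a) ->
  exists n, forall m q, (n <= m)%N -> Q m q -> valid m q -> U (pt a q).
Proof.
move=> oU Ul; have [n hn] := projT2 (cid (pt_limit a)) U oU Ul.
by exists n => m q nm Qq vq; apply/hn/(pt_decreasing nm); exists q.
Qed.

Lemma obj_map_closure a m : closure [set pt a q | q in Q m `&` valid m] (obj_map a).
Proof.
move=> V; rewrite nbhsE => -[U [oU Ul] UV].
have [n hn] := obj_map_near oU Ul.
have [q [Qq vq]] := Qv (maxn m n).
have Uq : U (pt a q) by exact: hn (leq_maxr m n) Qq vq.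
exists (pt a q); split; last exact: UV.
by apply: (pt_decreasing (leq_maxl m n)); exists q.
Qed.
Arguments obj_map_closure : clear implicits.

Lemma obj_map_mem a : C (obj_map a).
Proof.
apply: cC; apply: closureS (obj_map_closure a 0%N) => _ [q [_ vq] <-].
exact: valid_pt vq.
Qed.

Lemma obj_map_sep a a' m : a m = false -> a' m = true ->
  W m (obj_map a, obj_map a').
Proof.
move=> am am'; have [_ _ h _ _] := QP m; apply: (h a a' am am').
by split; apply: closureS (obj_map_closure _ m.+1); apply: image_subset; exact: subIsetl.
Qed.

Lemma obj_map_continuous : cyl_continuous obj_map.
Proof.
move=> a U oU Ul; have [_ sm_ex _] := smOP.
have [V [oV Vl cV _]] := sm_ex 0%N _ U oU Ul I.
have [n hn] := obj_map_near oV Vl.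
exists n => a' aa'; apply: cV; rewrite !setIT.
apply: closureS (obj_map_closure a' n) => _ [q [Qq vq] <-].
have -> : @pt Obj Arr n a' = pt a by apply: pt_ext.
exact: hn.
Qed.

Lemma edge_basis_ex k : exists i, forall q, Q k.+1 q -> b i q.2.
Proof. by have [] := QP k. Qed.

Definition gen_basis k := projT1 (cid (edge_basis_ex k)).

Lemma edge_basis k a q : Q k.+1 q -> b (gen_basis k) (edge G k a q).
Proof. by move=> Qq; rewrite /= eqxx; exact: projT2 (cid (edge_basis_ex k)) q Qq. Qed.

Lemma edge_limit k a : exists2 l, b (gen_basis k) l & forall U, open U -> U l ->
  exists2 m, (k < m)%N & [set edge G k a q | q in Q m `&` valid m] `<=` U.
Proof.
have [_ sm_lim] := smAP.
have [||||l bl hl] := sm_lim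
  (fun n => [set edge G k a q | q in Q (n + k).+1 `&` valid (n + k).+1]) _ _ _ (gen_basis k) 0%N.
- by move=> n; apply: edge_decreasing; rewrite !ltnS leq_addl/= addSn.
- by move=> n; have [q Qq] := Qv (n + k).+1; exists (edge G k a q); exists q.
- by move=> n; have [_ _ _ h _] := QP (n + k); apply: h; rewrite ?leq_addr ?leq_addl.
- by move=> _ [q [Qq _] <-]; exact: edge_basis.
exists l => // U oU Ul; have [n hn] := hl U oU Ul.
by exists (n + k).+1 => //; rewrite ltnS leq_addl.
Qed.

Definition gen k a : Arr := projT1 (cid2 (edge_limit k a)).

Lemma gen_in_basis k a : b (gen_basis k) (gen k a).
Proof. by rewrite /gen; case: cid2. Qed.

Lemma gen_near k a U : open U -> U (gen k a) -> exists2 n, (k < n)%N &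
  forall m q, (n <= m)%N -> Q m q -> valid m q -> U (edge G k a q).
Proof.
rewrite /gen; case: cid2 => l /= _ hl oU Ul; have [n kn hn] := hl U oU Ul.
exists n => // m q nm Qq vq; apply: hn; apply: (@edge_decreasing k a m n); first by rewrite kn.
by exists q.
Qed.

(** At every late stage the end points of the [k]-th arrow are given by [valid_edge]; as [src] and
    [rng] are continuous and [Obj] is Hausdorff, this survives in the limit. *)
Lemma gen_src_rng k a :
  src (gen k a) = obj_map (cut k false a) /\ rng (gen k a) = obj_map (cut k true a).
Proof.
have hO := polish_hausdorff (pg_polish_objects polishG).
split; apply: hO => V V'; rewrite !nbhsE => -[U [oU Ux] UV] [U' [oU' U'x] UV'].
  have [n kn hn] := gen_near (open_preimage (src_continuous polishG) oU) Ux.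
  have [n' hn'] := obj_map_near oU' U'x.
  have [q [Qq vq]] := Qv (maxn n n').
  have [e _] := valid_edge a vq (leq_trans kn (leq_maxl n n')).
  exists (src (edge G k a q)); split; first by apply: UV; exact: hn (leq_maxl _ _) Qq vq.
  by rewrite e; apply: UV'; exact: hn' (leq_maxr _ _) Qq vq.
have [n kn hn] := gen_near (open_preimage (rng_continuous polishG) oU) Ux.
have [n' hn'] := obj_map_near oU' U'x.
have [q [Qq vq]] := Qv (maxn n n').
have [_ e] := valid_edge a vq (leq_trans kn (leq_maxl n n')).
exists (rng (edge G k a q)); split; first by apply: UV; exact: hn (leq_maxl _ _) Qq vq.
by rewrite e; apply: UV'; exact: hn' (leq_maxr _ _) Qq vq.
Qed.

(** All limits of [k]-th arrows lie in the same basic set, which is regular. If [a'] shares with [a]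
    the arrows of a late stage, its limit lies in the closure of a small set around [gen k a]. *)
Lemma gen_continuous k : cyl_continuous (gen k).
Proof.
move=> a U oU Ul; have [sm [_ sm_ex _]] := bS (gen_basis k).
have [V [oV Vl cV _]] := sm_ex 0%N _ U oU Ul (gen_in_basis k a).
have [n kn hn] := gen_near (openI oV (bP.1 (gen_basis k))) (conj Vl (gen_in_basis k a)).
exists n => a' aa'; apply: cV; split; last exact: gen_in_basis.
move=> N; rewrite nbhsE => -[U' [oU' U'l] UN].
have [n' kn' hn'] := gen_near oU' U'l.
have [q [Qq vq]] := Qv (maxn n n').
exists (edge G k a' q); split; last by apply: UN; exact: hn' (leq_maxr _ _) Qq vq.
have [||q' [Qq' vq'] <-] := @edge_decreasing k a' (maxn n n') n _ (edge G k a' q).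
- by rewrite kn leq_maxl.
- by exists q.
have -> : @edge Obj Arr G n k a' = edge G k a.
  by apply: edge_ext => // i /andP[_ im]; exact: aa'.
exact: hn Qq' vq'.
Qed.

(* Arr need not be Hausdorff, so limits do not determine the product of two limit
   arrows: only the generators are defined as limits, and the other arrows are
   composed from them along the spanning tree. *)
Definition gen_or_id n a : Arr :=
  if a n then gen n (tail n.+1 a) else idn G (obj_map (tail n.+1 a)).

Lemma gen_or_id_src n a : src (gen_or_id n a) = obj_map (tail n.+1 a).
Proof.
rewrite /gen_or_id; case: ifP => _; last by rewrite src_idn.
by have [-> _] := gen_src_rng n (tail n.+1 a); rewrite cut_false tail_idem.
Qed.

Lemma gen_or_id_rng n a : rng (gen_or_id n a) = obj_map (tail n a).
Proof.
rewrite /gen_or_id; case: ifP => an; last by rewrite rng_idn (tailS an).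
by have [_ ->] := gen_src_rng n (tail n.+1 a); rewrite cut_true.
Qed.

Lemma gen_or_id_continuous n : cyl_continuous (gen_or_id n).
Proof.
move=> a U oU Ul.
suff [m hm] : exists m, forall a', agree m a a' -> a' n = a n -> U (gen_or_id n a').
  exists (maxn m n.+1) => a' aa'; apply: hm; last by apply: aa'; rewrite leq_max ltnSn orbT.
  exact: agree_sub (leq_maxl _ _) aa'.
move: Ul; rewrite /gen_or_id; case: (a n) => Ul.
  have [m hm] := gen_continuous oU Ul.
  by exists m => a' aa' ->; apply: hm; exact: agree_tail.
have [m hm] := obj_map_continuous (open_preimage (idn_continuous polishG) oU) Ul.
by exists m => a' aa' ->; apply: hm; exact: agree_tail.
Qed.

Fixpoint arr_to n a : Arr :=
  if n is n'.+1 then gcomp G (arr_to n' a) (gen_or_id n' a) else idn G (obj_map a).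

Lemma arr_to_src_rng n a : src (arr_to n a) = obj_map (tail n a) /\
  rng (arr_to n a) = obj_map a.
Proof.
elim: n => [|n [s r]] /=; first by rewrite src_idn rng_idn.
by rewrite src_comp ?rng_comp ?s ?gen_or_id_rng ?gen_or_id_src.
Qed.

Lemma cyl_continuous_comp (f g : (nat -> bool) -> Arr) :
  (forall a, src (f a) = rng (g a)) -> cyl_continuous f -> cyl_continuous g ->
  cyl_continuous (fun a => gcomp G (f a) (g a)).
Proof.
move=> fg cf cg a U oU Ul.
have [V [V' [oV oV' Vf Vg hV]]] := gcomp_nbhs polishG (fg a) oU Ul.
have [m hm] := cf a V oV Vf; have [m' hm'] := cg a V' oV' Vg.
exists (maxn m m') => a' aa'; apply: hV => //.
  by apply: hm; exact: agree_sub (leq_maxl _ _) aa'.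
by apply: hm'; exact: agree_sub (leq_maxr _ _) aa'.
Qed.

Lemma arr_to_continuous n : cyl_continuous (arr_to n).
Proof.
elim: n => [|n IH].
  move=> a U oU Ul.
  exact: obj_map_continuous (open_preimage (idn_continuous polishG) oU) Ul.
apply: cyl_continuous_comp => //; last exact: gen_or_id_continuous.
by move=> a; rewrite gen_or_id_rng; have [] := arr_to_src_rng n a.
Qed.

Definition arr_between n a a' : Arr := gcomp G (arr_to n a') (ginv G (arr_to n a)).

Lemma arr_between_composable n a a' : tail n a = tail n a' ->
  src (arr_to n a') = rng (ginv G (arr_to n a)).
Proof.
by move=> e; rewrite rng_inv (arr_to_src_rng n a').1 (arr_to_src_rng n a).1 e.
Qed.

Lemma arr_between_src n a a' : tail n a = tail n a' -> src (arr_between n a a') = obj_map a.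
Proof.
move=> /arr_between_composable e.
by rewrite /arr_between src_comp// src_inv (arr_to_src_rng n a).2.
Qed.

Lemma arr_between_rng n a a' : tail n a = tail n a' -> rng (arr_between n a a') = obj_map a'.
Proof.
move=> /arr_between_composable e.
by rewrite /arr_between rng_comp// (arr_to_src_rng n a').2.
Qed.

(** Beyond [n] the two paths coincide, so the extra generator meets its own inverse. Hence the level
    at which the paths are joined does not matter. *)
Lemma arr_betweenS n a a' : (forall i, (n <= i)%N -> a i = a' i) ->
  arr_between n.+1 a a' = arr_between n a a'.
Proof.
move=> h; have e : tail n a = tail n a'.
  by apply/funext => i; rewrite /tail; case: ltnP => // /h.
have eS : tail n.+1 a = tail n.+1 a'.
  by apply/funext => i; rewrite /tail; case: ltnP => // /ltnW/h.
have eg : gen_or_id n a = gen_or_id n a' by rewrite /gen_or_id h// eS.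
have sr : src (arr_to n a') = rng (gen_or_id n a').
  by rewrite gen_or_id_rng (arr_to_src_rng n a').1.
have sr' : src (arr_to n a) = rng (gen_or_id n a).
  by rewrite gen_or_id_rng (arr_to_src_rng n a).1.
have ii : src (ginv G (gen_or_id n a)) = rng (ginv G (arr_to n a)) by rewrite src_inv rng_inv.
rewrite /arr_between /= ginv_comp// Defs.compA//; last first.
  by rewrite src_comp// rng_inv eg.
rewrite -[X in gcomp G X _]Defs.compA ?rng_inv ?eg// comp_invr -sr comp_idr//.
Qed.

Lemma arr_between_add n k a a' : (forall i, (n <= i)%N -> a i = a' i) ->
  arr_between (k + n) a a' = arr_between n a a'.
Proof.
move=> h; elim: k => // k IH; rewrite addSn arr_betweenS// => i kni.
by apply: h; apply: leq_trans kni; exact: leq_addl.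
Qed.

Lemma arr_between_indep n n' a a' : (forall i, (n <= i)%N -> a i = a' i) ->
  (forall i, (n' <= i)%N -> a i = a' i) -> arr_between n a a' = arr_between n' a a'.
Proof.
by move=> h h'; rewrite -(arr_between_add n' h) -(arr_between_add n h') addnC.
Qed.

Lemma E0_bound (a a' : cantor_space) : E0 a a' ->
  exists n, forall i, (n <= i)%N -> a i = a' i.
Proof.
by move=> /finite_nat_bound[n hn]; exists n => i /hn; exact: contrapT.
Qed.

Definition arr_map (g : E0_arrow) : Arr :=
  arr_between (projT1 (cid (E0_bound (E0_arrowP g)))) (E0_src g) (E0_rng g).

Lemma eq_tail n (a a' : nat -> bool) : (forall i, (n <= i)%N -> a i = a' i) ->
  tail n a = tail n a'.
Proof. by move=> h; apply/funext => i; rewrite /tail; case: ltnP => // /h. Qed.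

Lemma arr_mapE n g : (forall i, (n <= i)%N -> E0_src g i = E0_rng g i) ->
  arr_map g = arr_between n (E0_src g) (E0_rng g).
Proof.
move=> h; apply: arr_between_indep => //.
exact: (projT2 (cid (E0_bound (E0_arrowP g)))).
Qed.

Lemma arr_map_src g : src (arr_map g) = obj_map (E0_src g).
Proof. by apply/arr_between_src/eq_tail; exact: (projT2 (cid (E0_bound (E0_arrowP g)))). Qed.

Lemma arr_map_rng g : rng (arr_map g) = obj_map (E0_rng g).
Proof. by apply/arr_between_rng/eq_tail; exact: (projT2 (cid (E0_bound (E0_arrowP g)))). Qed.

Lemma arr_map_functor : is_functor E0_groupoid G obj_map arr_map.
Proof.
split; [exact: arr_map_src|exact: arr_map_rng| |].
  move=> a; rewrite (@arr_mapE 0%N) // /arr_between /= comp_invr rng_idn.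
  by [].
move=> g h gh.
have [n1 h1] := E0_bound (E0_arrowP g); have [n2 h2] := E0_bound (E0_arrowP h).
(* At a level common to both arrows, the path of the middle point cancels in the product. *)
pose n := maxn n1 n2.
have h1' i : (n <= i)%N -> E0_src g i = E0_rng g i.
  by move=> ni; apply: h1; exact: leq_trans (leq_maxl _ _) ni.
have h2' i : (n <= i)%N -> E0_src h i = E0_rng h i.
  by move=> ni; apply: h2; exact: leq_trans (leq_maxr _ _) ni.
have [r s] := E0_compE gh.
rewrite (arr_mapE h1') (arr_mapE h2') (@arr_mapE n (E0_comp g h)); last first.
  by move=> i ni; rewrite r s h2'// -h1'//; congr (_ i); apply: esym.
rewrite r s /arr_between.
have e : E0_src g = E0_rng h := gh.
rewrite -e gcomp_cancel // ?(arr_to_src_rng _ _).1 ?(eq_tail h1')//.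
by rewrite (eq_tail h2') -e (eq_tail h1').
Qed.

Hypothesis W_diag : forall m p, W m p -> p.1 <> p.2.

Lemma obj_map_inj : injective obj_map.
Proof.
move=> a a' e; apply/funext => i; apply: contrapT => aa'.
case: (a i) (a' i) aa' (@obj_map_sep a a' i) (@obj_map_sep a' a i) => -[] // _ h1 h2.
  exact: (W_diag (h2 erefl erefl)).
exact: (W_diag (h1 erefl erefl)).
Qed.

Lemma arr_map_inj : injective arr_map.
Proof.
move=> g h e; apply: E0_arrow_eq; apply: obj_map_inj.
  by rewrite -!arr_map_rng e.
by rewrite -!arr_map_src e.
Qed.

(** On a sheet of [E0], where the translation [g] is fixed, one level [n] serves every point, so the
    map is a fixed finite composition of continuous ones. *)
Lemma arr_map_continuous : continuous arr_map.
Proof.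
apply/continuousP => U oU; rewrite /open /= /E0_open /= openE => -[g a] Uga.
have [n hn] : exists n, forall i, (n <= i)%N -> set_val g i = false.
  have /set_mem/finite_nat_bound[n hn] := valP g.
  by exists n => i /hn gi; apply: negbTE; apply/negP.
pose tr (a : nat -> bool) : nat -> bool := fun i => set_val g i (+) a i.
have e a' : arr_map (E0_chart (g, a')) = arr_between n a' (tr a').
  by rewrite (@arr_mapE n) // => i ni /=; rewrite hn.
have et a' : tail n a' = tail n (tr a').
  by apply: eq_tail => i ni; rewrite /tr hn.
have [m hm] : exists m, forall a', agree m a a' -> U (arr_between n a' (tr a')).
  have ct : cyl_continuous (fun a' => arr_to n (tr a')).
    move=> a1 V oV Va; have [m hm] := arr_to_continuous oV Va.
    by exists m => a' aa'; apply: hm => i im; rewrite /tr aa'.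
  have ci : cyl_continuous (fun a' => ginv G (arr_to n a')).
    move=> a1 V oV Va.
    exact: arr_to_continuous (open_preimage (pg_inv_continuous polishG) oV) Va.
  have cc := cyl_continuous_comp (fun a' => arr_between_composable (et a')) ct ci.
  by apply: cc => //; rewrite -/(arr_between n a (tr a)) -e.
exists ([set g], [set a' | agree m a a']); first by split; [exact: discrete_set1|exact: nbhs_agree].
by move=> [g' a'] /= [-> aa']; rewrite e; exact: hm.
Qed.

Hypothesis W_orbit : forall a a', C a -> C a' -> orbit_equiv G a a' ->
  exists k, forall m, (k <= m)%N -> ~ W m (a, a').

(** A difference at bit [m] puts the pair of images into [W m], in the order dictated by the two
    bits. If the images are equivalent, both orders are excluded for large [m], so only finitely
    many bits differ. *)
Lemma approx_E0_embeds : E0_embeds G.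
Proof.
exists obj_map, arr_map; split.
- exact: arr_map_functor.
- exact: arr_map_inj.
- exact: arr_map_continuous.
move=> a a'; split=> [aa'|].
  exists (arr_map (E0Arrow aa')); split; first exact: arr_map_rng.
  exact: arr_map_src.
move=> h; apply: contrapT => naa'.
have e1 : orbit_equiv G (obj_map a) (obj_map a') by exact: h.
have [k hk] := W_orbit (obj_map_mem a) (obj_map_mem a') e1.
have [k' hk'] := W_orbit (obj_map_mem a') (obj_map_mem a) (orbit_equiv_sym e1).
apply: naa'; apply: (@sub_finite_set _ _ `I_(maxn k k')); last exact: finite_II.
move=> m /= am; rewrite ltnNge; apply/negP; rewrite geq_max => /andP[km km'].
case: (a m) (a' m) am (@obj_map_sep a a' m) (@obj_map_sep a' a m) => -[] // _ h1 h2.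
  exact: hk' km' (h2 erefl erefl).
exact: hk km (h1 erefl erefl).
Qed.

End embedding.

Lemma closed_diagonal (T : topologicalType) : hausdorff_space T ->
  closed [set p : T * T | p.1 = p.2].
Proof.
move=> hT [x y] cxy /=; apply: hT => A B nA nB.
have [[u v] [/= -> [/= Av Bv]]] :=
  cxy (A `*` B) (ex_intro2 _ _ (A, B) (conj nA nB) (@subset_refl _ _)).
by exists v.
Qed.

(* A point interior to the diagonal would be isolated, but E contains it. *)
Lemma meager_diagonal (T : topologicalType) (C : set T) (E : set (T * T)) :
  (forall x, E (x, x)) -> meager_in (C `*` C) E ->
  dense_in (C `*` C) (~` [set p | p.1 = p.2]).
Proof.
move=> Er [N [cN dN EN]] W oW [[x y] [Wxy [/= Cx Cy]]]; apply: contrapT => h.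
have {}h p : W p -> C p.1 -> C p.2 -> p.1 = p.2.
  by move=> Wp C1 C2; apply: contrapT => np; apply: h; exists p.
have exy : x = y := h _ Wxy Cx Cy.
subst y.
have [[U V] [/= nU nV] UVW] : nbhs (x, x) W by exact: open_nbhs_nbhs.
move: nU nV; rewrite !nbhsE => -[U' [oU' U'x] UU'] [V' [oV' V'x] VV'].
have [k _ Nk] := EN (x, x) (conj (Er x) (conj Cx Cx)).
pose D := U' `&` V'.
have oD : open D by exact: openI.
have Dx y : D y -> C y -> y = x.
  by move=> [Uy Vy] Cy'; apply: (h (y, x)) => //; apply: UVW; split; [exact: UU'|exact: VV'].
have [||[u v] [[[/= Du Dv] Nuv] [/= Cu Cv]]] := dN k (D `*` D).
- exact: open_setX.
- by exists (x, x).
by apply: Nuv; rewrite (Dx u)// (Dx v).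
Qed.

Section dichotomy.
Variables (R : realType) (Obj Arr : topologicalType) (G : groupoid Obj Arr).
Hypothesis polishG : polish_groupoid R G.

Lemma meager_closure_E0_embeds (x : Obj) :
  let C := closure (orbit_of G x) in
  meager_in (C `*` C) [set p | orbit_equiv G p.1 p.2] -> E0_embeds G.
Proof.
move=> C mE.
have pO := pg_polish_objects polishG.
have cC : closed C by exact: closed_closure.
have iC : orbit_invariant G C := invariant_closure polishG (@invariant_orbit _ _ G x).
have [smO smOP] := polish_small_sets pO.
have [b [bP bS]] := locally_polish_basis (pg_locally_polish polishG).
have [smA smAP] := locally_polish_limit_sets bP bS.
have dD := meager_diagonal (fun y => orbit_equiv_refl G y) mE.
have [N [cN dN EN]] := mE.
(* Decreasing dense open sets: they avoid the diagonal for injectivity, and avoid [N 0] up to [N m],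
   so that every equivalent pair in [C] is excluded from some stage on. *)
pose W := fix W m : set (Obj * Obj) :=
  (if m is m'.+1 then W m' else ~` [set p | p.1 = p.2]) `&` ~` N m.
have WP m : [/\ open (W m), dense_in (C `*` C) (W m),
    W m `<=` ~` [set p | p.1 = p.2] & forall k, (k <= m)%N -> W m `<=` ~` N k].
  elim: m => [|m [oW dW Wd WN]] /=.
    have oD : open (~` [set p : Obj * Obj | p.1 = p.2]).
      exact/closed_openC/closed_diagonal/(polish_hausdorff pO).
    split; [by apply: openI => //; exact: closed_openC|exact: dense_inI|exact: subIsetl|].
    by move=> k; rewrite leqn0 => /eqP ->; exact: subIsetr.
  split; [by apply: openI => //; exact: closed_openC|exact: dense_inI| |].
    by apply: subset_trans Wd; exact: subIsetl.
  move=> k; rewrite leq_eqVlt => /orP[/eqP ->|km]; first exact: subIsetr.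
  by apply: subset_trans (WN k km); exact: subIsetl.
have xC : orbit_of G x `<=` C by exact: subset_closure.
pose T m := {Q : set (approx Obj Arr m) | open Q /\ Q `&` valid G C (m := m) !=set0}.
have T0 : exists x : Obj, C x by exists x; apply: xC; exact: orbit_equiv_refl.
have hT0 : open [set: approx Obj Arr 0] /\ [set: approx Obj Arr 0] `&` valid G C (m := 0) !=set0.
  by split; [exact: openT|have [y Cy] := T0; exists y].
have [|u [_ uP]] := @choice_dep T (fun m Q Q' =>
    refines G C smO smA b (W m) (sval Q) (sval Q')) (exist _ _ hT0).
  move=> m [Q [oQ vQ]]; have [oW dW _ _] := WP m.
  have [Q' [oQ' vQ' QQ']] :=
    approx_refine polishG iC smOP bP smAP oQ vQ oW dW (@subset_refl _ _) xC.
  by exists (exist _ Q' (conj oQ' vQ')).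
apply: (approx_E0_embeds polishG cC smOP bP smAP bS (W := W) (Q := fun m => sval (u m))).
- by move=> m; case: (u m) => Q [].
- exact: uP.
- by move=> m p Wp; have [_ _ h _] := WP m; exact: h.
move=> y y' Cy Cy' yy'; have [k _ Nk] := EN (y, y') (conj yy' (conj Cy Cy')).
by exists k => m km Wm; have [_ _ _ h] := WP m; exact: (h k km _ Wm).
Qed.

Lemma nonGdelta_orbit_E0_embeds (x : Obj) :
  (forall y, Gdelta (orbit_of G y) -> Fsigma (orbit_of G y)) ->
  ~ Gdelta (orbit_of G x) -> E0_embeds G.
Proof.
move=> GF nG; apply: (@meager_closure_E0_embeds x).
exact: (nonGdelta_orbit_meager polishG GF nG).
Qed.

End dichotomy.

(** * The Cantor space *)

Lemma nbhs_agreeP (a : cantor_space) (U : set cantor_space) :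
  nbhs a U <-> exists m, [set a' | agree m a a'] `<=` U.
Proof.
split=> [|[m]]; last by move=> mU; apply: filterS mU _; exact: nbhs_agree.
pose F : set_system cantor_space := filter_from setT (fun m => [set a' | agree m a a']).
have FF : Filter F.
  apply: filter_from_filter; first by exists 0%N.
  move=> i j _ _; exists (maxn i j) => // a' h; split; apply: agree_sub h.
    exact: leq_maxl.
  exact: leq_maxr.
have : F --> a.
  apply/(@pointwise_cvgP nat bool F a FF) => i A nA.
  by exists i.+1 => // a' h; rewrite /= (h i (ltnSn i)); exact: nbhs_singleton.
by move=> h /h [m _ mU]; exists m.
Qed.

Definition cylinder (s : seq bool) : set cantor_space :=
  [set a | agree (size s) (nth false s) a].

Lemma agree_sym m a a' : agree m a a' -> agree m a' a.
Proof. by move=> h i /h ->. Qed.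

Lemma agree_trans m a b c : agree m a b -> agree m b c -> agree m a c.
Proof. by move=> ab bc i im; rewrite bc// ab. Qed.

Lemma agree_mkseq m (a : nat -> bool) : agree m (nth false (mkseq a m)) a.
Proof. by move=> i im; rewrite nth_mkseq. Qed.

Lemma cylinder_mkseq m (a : cantor_space) : cylinder (mkseq a m) = [set a' | agree m a a'].
Proof.
apply/seteqP; split=> a'; rewrite /cylinder /= size_mkseq => h.
  exact: agree_trans (agree_sym (@agree_mkseq m a)) h.
exact: agree_trans (@agree_mkseq m a) h.
Qed.

Lemma cylinder_open s : open (cylinder s).
Proof.
rewrite openE => a sa; apply/nbhs_agreeP; exists (size s) => a'; exact: agree_trans.
Qed.

Lemma open_cylinderE (U : set cantor_space) : open U ->
  U = \bigcup_(s in [set s | cylinder s `<=` U]) cylinder s.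
Proof.
move=> oU; apply/seteqP; split=> [a Ua|a [s sU sa]]; last exact: sU.
have /nbhs_agreeP[m mU] : nbhs a U by exact: open_nbhs_nbhs.
by exists (mkseq a m); rewrite /= cylinder_mkseq.
Qed.

Lemma borel_open (T : topologicalType) (U : set T) : open U -> borel U.
Proof. exact: sub_sigma_algebra. Qed.

Lemma borelC (T : topologicalType) (A : set T) : borel A -> borel (~` A).
Proof. by rewrite -setTD; exact: sigma_algebraCD. Qed.

Lemma borel_bigcup (T : topologicalType) (A : nat -> set T) :
  (forall n, borel (A n)) -> borel (\bigcup_n A n).
Proof. exact: sigma_algebra_bigcup. Qed.

Lemma borel_bigcap (T : topologicalType) (A : nat -> set T) :
  (forall n, borel (A n)) -> borel (\bigcap_n A n).
Proof.
move=> bA; rewrite -[\bigcap_n _]setCK setC_bigcap; apply: borelC.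
by apply: borel_bigcup => n; exact: borelC.
Qed.

Lemma borelU (T : topologicalType) (A B : set T) : borel A -> borel B -> borel (A `|` B).
Proof.
move=> bA bB; rewrite (_ : A `|` B = \bigcup_n (if n is 0 then A else B)).
  by apply: borel_bigcup; case.
apply/seteqP; split=> [x [Ax|Bx]|x [[|n] _ h]].
- by exists 0%N.
- by exists 1%N.
- by left.
- by right.
Qed.

Lemma borel_closed (T : topologicalType) (A : set T) : closed A -> borel A.
Proof. move=> cA; rewrite -[A]setCK; apply: borelC; apply: borel_open; exact: closed_openC. Qed.

Lemma borelT (T : topologicalType) : borel [set: T].
Proof. by apply: borel_open; exact: openT. Qed.

Lemma borel_cylinder s : borel (cylinder s).
Proof. by apply: borel_open; exact: cylinder_open. Qed.

Lemma borel_preimage (S : topologicalType) (T : Type) (G H : set (set T)) (f : S -> T) :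
  <<s H >> `<=` <<s G >> -> (forall A, G A -> borel (f @^-1` A)) ->
  forall A, <<s H >> A -> borel (f @^-1` A).
Proof.
move=> HG h A /HG; suff : <<s G >> `<=` [set A | borel (f @^-1` A)] by apply.
apply: smallest_sub => //; split.
- by rewrite /= preimage_set0; by apply: borel_open; exact: open0.
- by move=> B bB; rewrite /= setTD preimage_setC; exact: borelC.
- by move=> F bF; rewrite /= preimage_bigcup; exact: borel_bigcup.
Qed.

Lemma sigma_cylinder : (@borel cantor_space) = <<s range cylinder >>.
Proof.
rewrite /borel; apply/seteqP; split; apply: smallest_sub.
- exact: smallest_sigma_algebra.
- move=> U oU; pose F n := if unpickle n is Some s then
    if pselect (cylinder s `<=` U) then cylinder s else set0 else set0.
  have hF n : <<s range cylinder >> (F n).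
    rewrite /F; case: unpickle => [s|]; last exact: sigma_algebra0.
    case: pselect => h; last exact: sigma_algebra0.
    by apply: sub_sigma_algebra; exists s.
  rewrite (_ : U = \bigcup_n F n); first exact: sigma_algebra_bigcup.
  rewrite [LHS]open_cylinderE//; apply/seteqP; split=> [a [s sU sa]|a [n _]].
    by exists (pickle s) => //; rewrite /F pickleK; case: pselect.
  by rewrite /F; case: unpickle => [s|//]; case: pselect => // sU sa; exists s.
- exact: smallest_sigma_algebra.
- by move=> _ [s _ <-]; exact: borel_cylinder.
Qed.

Lemma borel_fun_cantor (S : topologicalType) (f : S -> cantor_space) :
  (forall n, borel [set x | f x n = true]) -> borel_fun f.
Proof.
move=> h B; apply: (borel_preimage (G := range cylinder)).
  by rewrite -sigma_cylinder.
move=> _ [s _ <-].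
rewrite (_ : f @^-1` _ = \bigcap_i (if (i < size s)%N then
    if nth false s i then [set x | f x i = true] else ~` [set x | f x i = true] else setT)).
  apply: borel_bigcap => i; case: ifP => _; last exact: borelT.
  by case: nth => //; exact: borelC.
apply/seteqP; split=> x.
  by move=> sx i _; case: ifP => // /sx; case: nth => /= ->.
by move=> sx i si; have := sx i I; rewrite si; case: nth => //=; case: (f x i).
Qed.

Section cantor_metric.
Variable R : realType.
Local Open Scope ring_scope.

(* An alias depending on R, for an instance of [metricType R]. *)
Definition cantor_metric : Type := let _ := R in cantor_space.
HB.instance Definition _ := Choice.copy cantor_metric cantor_space.

(** With first difference at [n], the distance is [1 / (n + 1)]: an ultrametric whose balls are
    cylinders. *)
Definition cantor_dist (a b : cantor_metric) : R :=
  if pselect (exists n, a n != b n) is left e then natSinv R (ex_minn e) else 0.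

Lemma cantor_dist_lt n a b : (cantor_dist a b < natSinv R n) <-> agree n.+1 a b.
Proof.
rewrite /cantor_dist; case: pselect => [e|ne]; last first.
  rewrite natSinv_gt0; split=> // _ i _; apply: contrapT => /eqP; rewrite eq_sym => h.
  by apply: ne; exists i.
case: ex_minnP => m abm mmin; split.
  move=> mn i i_n; apply: contrapT => /eqP; rewrite eq_sym => /mmin mi.
  by have := natSinv_le R (leq_trans mi i_n); rewrite leNgt mn.
move=> h; have nm : (n < m)%N.
  by rewrite ltnNge; apply/negP => mn; move: abm; rewrite h ?eqxx// ltnS.
by rewrite /natSinv ltf_pV2 ?posrE ?ltr0n// ltr_nat.
Qed.

Lemma cantor_dist_ge0 a b : 0 <= cantor_dist a b.
Proof.
by rewrite /cantor_dist; case: pselect => // e; exact/ltW/natSinv_gt0.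
Qed.

Lemma cantor_dist_case a b : cantor_dist a b = 0 \/ exists n, cantor_dist a b = natSinv R n.
Proof.
rewrite /cantor_dist; case: pselect => [e|_]; last by left.
by right; exists (ex_minn e).
Qed.

Lemma cantor_distxx a : cantor_dist a a = 0.
Proof.
by rewrite /cantor_dist; case: pselect => // e; have [n] := e; rewrite eqxx.
Qed.

Lemma cantor_dist_eq0 a b : cantor_dist a b = 0 -> a = b.
Proof.
move=> ab; apply/funext => n; apply/esym.
have /cantor_dist_lt : cantor_dist a b < natSinv R n by rewrite ab natSinv_gt0.
by apply.
Qed.

Lemma cantor_dist_sym a b : cantor_dist a b = cantor_dist b a.
Proof.
have le x y : cantor_dist x y <= cantor_dist y x.
  rewrite leNgt; apply/negP => yx.
  have [e|[n e]] := cantor_dist_case x y.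
    by move: yx; rewrite e ltNge cantor_dist_ge0.
  have /cantor_dist_lt/agree_sym/cantor_dist_lt : cantor_dist y x < natSinv R n by rewrite -e.
  by rewrite e ltxx.
by apply/eqP; rewrite eq_le !le.
Qed.

Lemma cantor_dist_triangle b a c : cantor_dist a c <= cantor_dist a b + cantor_dist b c.
Proof.
rewrite leNgt; apply/negP => h.
have [e|[n e]] := cantor_dist_case a c.
  by move: h; rewrite e ltNge addr_ge0 ?cantor_dist_ge0.
have ab : cantor_dist a b < natSinv R n.
  by rewrite -e; apply: le_lt_trans h; rewrite lerDl cantor_dist_ge0.
have bc : cantor_dist b c < natSinv R n.
  by rewrite -e; apply: le_lt_trans h; rewrite lerDr cantor_dist_ge0.
have /cantor_dist_lt : agree n.+1 a c.
  by apply: agree_trans; apply/cantor_dist_lt; [exact: ab|exact: bc].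
by rewrite e ltxx.
Qed.

HB.instance Definition _ := isMetric.Build R cantor_metric
  cantor_distxx cantor_dist_eq0 cantor_dist_sym cantor_dist_triangle.

Lemma nbhs_cantor_metric (a : cantor_metric) (U : set cantor_metric) :
  nbhs a U <-> exists m, [set a' | agree m a a'] `<=` U.
Proof.
rewrite -nbhs_ballE; split=> [[e /= e0 aU]|[m mU]].
  have [n ne] := exists_natSinv_lt e0.
  exists n.+1 => a' /= aa'; apply: aU; rewrite ballEmdist /=.
  by apply: lt_trans ne; apply/cantor_dist_lt.
exists (natSinv R m); first exact: natSinv_gt0.
rewrite ballEmdist => a' /= /cantor_dist_lt aa'; apply: mU.
exact: agree_sub aa'.
Qed.

Lemma polish_cantor_space : polish R cantor_space.
Proof.
split.
  exists (range (fun s : seq bool => nth false s : cantor_space)).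
    exact: card_le_trans (card_image_le _ _) (countableP _).
  move=> U [a Ua] oU; have /nbhs_agreeP[m mU] : nbhs a U by exact: open_nbhs_nbhs.
  exists (nth false (mkseq a m)); split; last by exists (mkseq a m).
  exact/mU/agree_sym/agree_mkseq.
exists cantor_metric, id; split.
  split; first by exists id.
    by move=> a U /nbhs_cantor_metric ?; apply/nbhs_agreeP.
  move=> U oU; rewrite image_id openE => a Ua; apply/nbhs_cantor_metric.
  by apply/nbhs_agreeP; exact: open_nbhs_nbhs.
move=> F FF /cauchyP cF.
have /choice[u uF] : forall n, exists a : cantor_metric, F [set a' | agree n.+1 a a'].
  move=> n; have [a aF] := cF _ (natSinv_gt0 R n); exists a.
  by apply: filterS aF => a'; rewrite ballEmdist => /cantor_dist_lt.
(* [u n] determines the first [n.+1] bits on a set of the filter, so the limit takes its bit [n]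
   from [u n]. *)
exists (fun n => u n n) => U /nbhs_cantor_metric[m mU].
suff : F [set a' | agree m (fun n => u n n) a'] by apply: filterS.
elim: {U mU} m => [|m IH]; first by apply: filterS filterT => a' _ i.
apply: filterS (filterI IH (uF m)) => a' [/= h hm] i.
by rewrite ltnS leq_eqVlt => /orP[/eqP ->|/h//]; apply: hm.
Qed.

End cantor_metric.

(** * Smoothness *)

Lemma open_section (S T : topologicalType) (U : set (S * T)) x :
  open U -> open [set y | U (x, y)].
Proof.
move=> oU; rewrite openE => y Uy.
have [[V W] [/= nV nW] VWU] : nbhs (x, y) U by exact: open_nbhs_nbhs.
by apply: filterS nW => z Wz; apply: VWU; split=> //; exact: nbhs_singleton.
Qed.

Lemma dense_Gdelta_meet (T : topologicalType) (C A B : set T) : baire C ->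
  A !=set0 -> A `<=` C -> C `<=` closure A -> C `<=` closure B -> B `<=` C ->
  Gdelta A -> Gdelta B -> A `&` B !=set0.
Proof.
move=> bC [a Aa] AC CA CB BC [F oF AF] [H oH BH].
have [|||k|x [Cx _ hx]] := bC setT (fun k => if odd k then F k./2 else H k./2).
- exact: openT.
- by exists a; split=> //; exact: AC.
- by move=> k; case: odd.
- case: ifP => _ W oW [z [Wz Cz]].
    have [y [Ay Wy]] := CA _ Cz W (open_nbhs_nbhs (conj oW Wz)).
    by exists y; split; [split=> //; move: Ay; rewrite AF; apply|exact: AC].
  have [y [By Wy]] := CB _ Cz W (open_nbhs_nbhs (conj oW Wz)).
  by exists y; split; [split=> //; move: By; rewrite BH; apply|exact: BC].
exists x; split.
  by rewrite AF => n _; have := hx n.*2.+1; rewrite /= odd_double /= uphalf_double.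
by rewrite BH => n _; have := hx n.*2; rewrite odd_double doubleK.
Qed.

Section orbits.
Variables (R : realType) (Obj Arr : topologicalType) (G : groupoid Obj Arr).
Hypothesis polishG : polish_groupoid R G.
Variable b : nat -> set Obj.
Hypothesis bP : enum_basis b.

Lemma open_in_closure_Gdelta (A : set Obj) : open_in_closure A -> Gdelta A.
Proof.
move=> [U oU ->]; apply: GdeltaI; first exact: open_Gdelta.
apply: (polish_closed_Gdelta (pg_polish_objects polishG)); exact: closed_closure.
Qed.

Lemma saturation_equiv U x y : orbit_equiv G x y -> saturation G U x -> saturation G U y.
Proof.
move=> xy /saturationP[z Uz xz]; apply/saturationP; exists z => //.
exact: orbit_equiv_trans (orbit_equiv_sym xy) xz.
Qed.

Lemma saturation_closure x y : (forall n, saturation G (b n) x -> saturation G (b n) y) ->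
  closure (orbit_of G y) x.
Proof.
move=> h V; rewrite nbhsE => -[U [oU Ux] UV]; have [n bx bU] := bP.2 _ _ oU Ux.
have /saturationP[z bz yz] : saturation G (b n) y.
  by apply: h; apply/saturationP; exists x => //; exact: orbit_equiv_refl.
by exists z; split=> //; apply/UV/bU.
Qed.

Hypothesis GO : forall x, Gdelta (orbit_of G x).

(* Orbits with the same closure C are dense Gdelta subsets of C, hence meet. *)
Lemma orbit_equiv_saturation x y : orbit_equiv G x y <->
  forall n, saturation G (b n) x <-> saturation G (b n) y.
Proof.
split=> [xy n|h].
  by split; apply: saturation_equiv => //; exact: orbit_equiv_sym.
have xy : closure (orbit_of G y) x by apply: saturation_closure => n /h.
have yx : closure (orbit_of G x) y by apply: saturation_closure => n /h.
have sub u v : closure (orbit_of G u) v -> orbit_of G v `<=` closure (orbit_of G u).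
  move=> uv w vw; exact: (invariant_closure polishG (@invariant_orbit _ _ G u)) vw uv.
have cl u v : closure (orbit_of G u) v -> closure (orbit_of G v) `<=` closure (orbit_of G u).
  move=> uv; rewrite [X in _ `<=` X](closure_id _).1; last exact: closed_closure.
  by apply: closureS; exact: sub.
have bC : baire (closure (orbit_of G x)).
  by apply: (polish_closed_baire (pg_polish_objects polishG)); exact: closed_closure.
have [|||||z [xz yz]] := dense_Gdelta_meet bC _ _ _ _ _ (GO x) (GO y).
- by exists x; exact: orbit_equiv_refl.
- exact: subset_closure.
- by [].
- exact: cl.
- exact: sub.
exact: orbit_equiv_trans xz (orbit_equiv_sym yz).
Qed.

Lemma Gdelta_orbits_smooth : smooth R (orbit_equiv G).
Proof.
exists cantor_space; first exact: polish_cantor_space.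
exists (fun x n => `[< saturation G (b n) x >]).
  apply: borel_fun_cantor => n; rewrite (_ : mkset _ = saturation G (b n)).
    by apply: borel_open; apply: (saturation_open polishG); exact: bP.1.
  by apply/seteqP; split=> x /asboolP.
move=> x y; rewrite orbit_equiv_saturation; split=> [h|h n].
  by apply/funext => n; apply/asbool_equiv_eq/h.
have := congr1 (fun a : cantor_space => a n) h => /= e.
by split=> /asboolP; [rewrite e|rewrite -e] => /asboolP.
Qed.

Lemma Gdelta_orbits_Gdelta :
  Gdelta [set p : Obj * Obj | orbit_equiv G p.1 p.2].
Proof.
rewrite (_ : mkset _ = \bigcap_n [set p | saturation G (b n) p.1 <-> saturation G (b n) p.2]).
  apply: Gdelta_bigcap => n; set U := saturation G (b n).
  have oU : open U by apply: (saturation_open polishG); exact: bP.1.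
  have [W oW UW] : Gdelta (~` U).
    by apply: (polish_closed_Gdelta (pg_polish_objects polishG)); exact: open_closedC.
  have hW x : ~ U x <-> forall j, W j x.
    split=> [nU j|h]; first by have : (~` U) x by []; rewrite UW; apply.
    by have : (~` U) x by rewrite UW => j _; exact: h.
  (* Both points lie in [U] or both in its complement, which is the intersection of the open sets
     [W j]. A pair outside the square of [U] must lie in the squares of all the [W j]. *)
  exists (fun j => U `*` U `|` W j `*` W j).
    by move=> j; apply: openU; exact: open_setX.
  apply/seteqP; split=> [[x y] /= xy j _|[x y] h /=].
    have [Ux|Ux] := pselect (U x); [left|right]; split=> //=; first exact/xy.
      exact: (hW x).1.
    by apply: (hW y).1 => // /xy.
  have [[//]|nxy] := pselect (U x /\ U y).
  have {}h j : W j x /\ W j y by have [[/= ? ?]|//] := h j I; exfalso; exact: nxy.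
  have nx : ~ U x by apply/hW => j; have [] := h j.
  by have ny : ~ U y by apply/hW => j; have [] := h j.
apply/seteqP; split=> [[x y] /= /orbit_equiv_saturation h n _|[x y] h]; first exact: h.
by apply/orbit_equiv_saturation => n; exact: h.
Qed.

End orbits.

Lemma Gdelta_equiv_Gdelta_orbit (Obj Arr : topologicalType) (G : groupoid Obj Arr) (x : Obj) :
  Gdelta [set p : Obj * Obj | orbit_equiv G p.1 p.2] ->
  Gdelta (orbit_of G x).
Proof.
move=> [F oF EF]; exists (fun n => [set y | F n (x, y)]).
  by move=> n; exact: open_section.
apply/seteqP; split=> y xy.
  by move=> n _; have : [set p | orbit_equiv G p.1 p.2] (x, y) by []; rewrite EF; apply.
by have : [set p | orbit_equiv G p.1 p.2] (x, y) by rewrite EF => n _; exact: xy.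
Qed.

Section nonatomic_ergodic.
Variables (R : realType) (T : topologicalType) (x0 : T) (E : T -> T -> Prop).
Variable mu : probability (borel_space x0) R.

(* By ergodicity a Borel invariant map into a Polish space is almost everywhere
   constant. *)
Lemma nonatomic_ergodic_not_smooth : nonatomic E mu -> ergodic E mu -> ~ smooth R E.
Proof.
move=> na erg [Y pY [f bf fE]].
have [b bP] := polish_basis pY; have hY := polish_hausdorff pY.
pose A n := f @^-1` (b n).
have bA n : borel (A n) by apply: bf; apply: borel_open; exact: bP.1.
have iA n x y : E x y -> A n x -> A n y by move=> /fE; rewrite /A /preimage /= => ->.
(* By ergodicity this is whichever of [A n] and its complement is null. *)
pose N n := if pselect (mu (A n) = 0%E) then A n else ~` A n.
have negN n : mu.-negligible (N n : set (borel_space x0)).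
  rewrite /N; case: pselect => h.
    by exists (A n); split => //; exact: bA.
  exists (~` A n); split=> //; first exact: (@borelC T _ (bA n)).
  have [//|h1] := erg (A n) (bA n) (iA n).
  rewrite probability_setC//; last exact: bA.
  by rewrite h1 subee.
(* Two points avoiding every [N n] lie in the same sets [A n], so their images under [f] have the
   same basic neighbourhoods. *)
have sep x y : ~ (\bigcup_n N n) x -> ~ (\bigcup_n N n) y -> E x y.
  move=> nx ny; apply/fE/hY => V W; rewrite nbhsE => -[U [oU Ux] UV] nW.
  have [n bx bU] := bP.2 _ _ oU Ux.
  have Ax : A n x by [].
  suff Ay : A n y by exists (f y); split; [exact/UV/bU|exact: nbhs_singleton].
  apply: contrapT => nAy.
  have Nn z : ~ (\bigcup_n N n) z -> ~ N n z by move=> h Nz; apply: h; exists n.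
  have := Nn _ nx; have := Nn _ ny; rewrite /N; case: pselect => h; by [].
have negU : mu.-negligible (\bigcup_n N n : set (borel_space x0)).
  exact: negligible_bigcup.
suff : mu.-negligible [set: borel_space x0].
  move=> /(negligibleP mu measurableT) e.
  have /eqP := etrans (esym (probability_setT mu)) e.
  by rewrite onee_eq0.
have [[x nx]|h] := pselect (exists x, ~ (\bigcup_n N n) x).
  apply: negligibleS (negligibleU negU (na x)) => y _.
  have [Ny|Ny] := pselect ((\bigcup_n N n) y); [by left|by right; exact: sep].
apply: negligibleS negU => y _; apply: contrapT => ny; by apply: h; exists y.
Qed.

End nonatomic_ergodic.

(** * Coin tossing *)

Section binary_digits.
Variable R : realType.
Local Open Scope ring_scope.

(** The doubling map modulo 1; the position of its iterates relative to one half gives the binary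
    digits. *)
Definition dbl (x : R) : R := if x < 2^-1 then 2 * x else 2 * x - 1.

Definition digits (x : R) : nat -> bool := fun n => 2^-1 <= iter n dbl x.

Lemma digitsS x n : digits x n.+1 = digits (dbl x) n.
Proof. by rewrite /digits iterSr. Qed.

Lemma dbl_itv x : 0 <= x < 1 -> 0 <= dbl x < 1.
Proof.
move=> /andP[x0 x1]; rewrite /dbl; case: ltP => h; apply/andP; split; lra.
Qed.

Lemma cylinder_cons c s (a : nat -> bool) :
  cylinder (c :: s) a <-> a 0%N = c /\ cylinder s (fun n => a n.+1).
Proof.
split=> [h|[a0 h]]; last by case=> [//|i] /h.
by split; [exact: (h 0%N)|move=> i is_; exact: (h i.+1)].
Qed.

(** Prefixing a digit [c] halves the dyadic interval of the word and places it in the left or right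
    half of the unit interval. *)
Lemma digits_cylinder s : exists a, [/\ 0 <= a, a + 2^-1 ^+ size s <= 1 &
  forall x, 0 <= x < 1 -> (cylinder s (digits x) <-> a <= x < a + 2^-1 ^+ size s)].
Proof.
elim: s => [|c s [a [a0 a1 ha]]].
  by exists 0; split; rewrite ?expr0 ?add0r// => x x01; split=> // _ i.
set e := 2^-1 ^+ size s in a1 ha *.
have eS : 2^-1 ^+ size (c :: s) = e / 2 by rewrite /= exprS mulrC.
have e0 : 0 < e by rewrite exprn_gt0// invr_gt0.
exists (a / 2 + if c then 2^-1 else 0); rewrite eS; split.
- by case: c {eS}; lra.
- by case: c {eS}; lra.
move=> x x01; have {}ha := ha _ (dbl_itv x01).
rewrite cylinder_cons (_ : (fun n => _) = digits (dbl x)); last first.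
  by apply/funext => n; rewrite digitsS.
rewrite ha /digits /= /dbl; move: x01 => /andP[x0 x1].
case: (ltP x 2^-1) => h; case: c {eS}; split.
- by case.
- by move=> /andP[h1 h2]; exfalso; lra.
- by move=> [_ /andP[h1 h2]]; apply/andP; split; lra.
- by move=> /andP[h1 h2]; split=> //; apply/andP; split; lra.
- by move=> [_ /andP[h1 h2]]; apply/andP; split; lra.
- by move=> /andP[h1 h2]; split=> //; apply/andP; split; lra.
- by case.
- by move=> /andP[h1 h2]; exfalso; lra.
Qed.

End binary_digits.

Section coin.
Variable R : realType.
Local Open Scope ring_scope.

Notation cantor_borel := (borel_space ((fun=> false) : cantor_space)).

Definition unit_itv : set R := `[0%R, 1%R[%classic.

Definition unit_digits (x : R) : cantor_borel :=
  if (0 <= x < 1)%R then digits x else fun=> false.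

Lemma measurable_unit_itv : measurable unit_itv.
Proof. exact: measurable_itv. Qed.

Lemma unit_digits_cylinder s : exists a : R, [/\ (0 <= a)%R, (a + 2^-1 ^+ size s <= 1)%R &
  unit_digits @^-1` cylinder s `&` unit_itv = `[a, a + 2^-1 ^+ size s[%classic].
Proof.
have [a [a0 a1 ha]] := digits_cylinder R s; exists a; split=> //.
apply/seteqP; split=> x; rewrite /unit_itv /preimage /= !in_itv /= /unit_digits.
  by move=> [+ x01]; rewrite x01 => /(ha _ x01).
move=> ax; have x01 : (0 <= x < 1)%R.
  by move: ax => /andP[ax xa]; apply/andP; split; lra.
by rewrite x01; split=> //; apply/(ha _ x01).
Qed.

Lemma measurable_unit_digits : measurable_fun setT unit_digits.
Proof.
apply: (@measurability _ _ _ cantor_borel setT unit_digits (range cylinder)).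
  exact: sigma_cylinder.
move=> _ [_ [s _ <-] <-]; rewrite setTI.
have [a [_ _ ea]] := unit_digits_cylinder s.
rewrite -(setIT (unit_digits @^-1` _)) -(setUv unit_itv) setIUr ea.
apply: measurableU; first exact: measurable_itv.
have [f|f] := pselect (cylinder s (fun=> false)).
  rewrite (_ : _ `&` _ = ~` unit_itv).
    by apply: measurableC; exact: measurable_unit_itv.
  apply/seteqP; split=> x; rewrite /unit_itv /preimage /= in_itv /= /unit_digits.
    by case.
  by move=> /negP/negbTE ->.
rewrite (_ : _ `&` _ = set0); first exact: measurable0.
apply/seteqP; split=> x //; rewrite /unit_itv /preimage /= in_itv /= /unit_digits.
by move=> [+ /negP/negbTE e]; rewrite e.
Qed.

(** The coin tossing measure, as the law of the binary digits of a uniform point of the unit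
    interval. *)
Definition coin (A : set cantor_borel) : \bar R :=
  lebesgue_measure (unit_digits @^-1` A `&` unit_itv).

Let coin0 : coin set0 = 0%E.
Proof. by rewrite /coin preimage_set0 set0I measure0. Qed.

Let coin_ge0 A : (0 <= coin A)%E.
Proof. exact: measure_ge0. Qed.

Let coin_sigma_additive : semi_sigma_additive coin.
Proof.
move=> F mF tF mUF; rewrite /coin preimage_bigcup setI_bigcupl.
have mD A : measurable A -> measurable (unit_digits @^-1` A `&` unit_itv).
  move=> mA; apply: measurableI; last exact: measurable_unit_itv.
  by rewrite -[X in measurable X]setTI; exact: measurable_unit_digits.
apply: measure_semi_sigma_additive.
- by move=> n; exact: mD.
- apply/trivIsetP => /= i j _ _ ij.
  move/trivIsetP : tF => /(_ i j I I ij) e.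
  rewrite setIACA -preimage_setI e preimage_set0 set0I//.
- by rewrite -setI_bigcupl -preimage_bigcup; exact: mD.
Qed.

HB.instance Definition _ := isMeasure.Build _ _ _ coin coin0 coin_ge0 coin_sigma_additive.

Lemma coin_cylinder s : coin (cylinder s) = (2^-1 ^+ size s)%:E.
Proof.
have [a [_ _ ea]] := unit_digits_cylinder s.
rewrite /coin ea lebesgue_measure_itv /= lte_fin ltrDl exprn_gt0 ?invr_gt0//.
by rewrite -EFinD; congr (_%:E)%E; rewrite addrC addKr.
Qed.

Lemma cylinder_nil : cylinder [::] = setT.
Proof. by apply/seteqP; split. Qed.

Let coinT : coin setT = 1%E.
Proof. by rewrite -cylinder_nil coin_cylinder expr0. Qed.

HB.instance Definition _ := Measure_isProbability.Build _ _ _ coin coinT.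

Lemma cylinderI s t : cylinder s `&` cylinder t = set0 \/
  exists u, cylinder s `&` cylinder t = cylinder u.
Proof.
wlog st : s t / (size s <= size t)%N.
  move=> h; have [|/ltnW] := leqP (size s) (size t); first exact: h.
  by move=> /h; rewrite setIC.
have [e|ne] := pselect (agree (size s) (nth false s) (nth false t)).
  right; exists t; apply/seteqP; split=> [a []//|a ta]; split=> //.
  exact: agree_trans e (agree_sub st ta).
left; apply/seteqP; split=> // a [sa ta]; apply: ne.
exact: agree_trans sa (agree_sym (agree_sub st ta)).
Qed.

(** Two cylinders are nested or disjoint, so with the empty set they form a generating family stable
    under intersection. *)
Lemma borel_measure_unique (m1 m2 : {measure set cantor_borel -> \bar R}) :
  (m1 setT < +oo)%E -> (forall s, m1 (cylinder s) = m2 (cylinder s)) ->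
  forall A, borel A -> m1 A = m2 A.
Proof.
move=> m1T h A bA.
pose H : set (set cantor_borel) := [set B | B = set0 \/ exists s, B = cylinder s].
have sH : @measurable _ cantor_borel = <<s H >>.
  rewrite [LHS]sigma_cylinder; apply/seteqP; split; apply: smallest_sub.
  - exact: smallest_sigma_algebra.
  - by move=> _ [s _ <-]; apply: sub_sigma_algebra; right; exists s.
  - exact: smallest_sigma_algebra.
  - move=> _ [->|[s ->]]; first exact: sigma_algebra0.
    by apply: sub_sigma_algebra; exists s.
apply: (measure_unique H (fun=> setT) sH) => //.
- move=> _ _ [->|[s ->]] [->|[t ->]]; rewrite ?set0I ?setI0; try by left.
  by have [->|[u ->]] := cylinderI s t; [left|right; exists u].
- by move=> _; right; exists [::]; rewrite cylinder_nil.
- by apply/seteqP; split=> // x _; exists 0%N.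
- by move=> _ [->|[s ->]]; rewrite ?measure0.
Qed.

Definition flip (k : nat) (a : cantor_borel) : cantor_borel := fun n => (n == k) (+) a n.

Lemma flipK k : involutive (flip k).
Proof. by move=> a; apply/funext => n; rewrite /flip addbA addbb. Qed.

Lemma flip_cylinder k s : flip k @^-1` cylinder s =
  cylinder (mkseq (fun n => (n == k) (+) nth false s n) (size s)).
Proof.
apply/seteqP; split=> a h i; rewrite ?size_mkseq => is_.
  by rewrite nth_mkseq// -h// /flip addbA addbb.
by rewrite /flip h ?size_mkseq// nth_mkseq// addbA addbb.
Qed.

Lemma measurable_flip k : measurable_fun setT (flip k).
Proof.
apply: (@measurability _ _ _ cantor_borel setT (flip k) (range cylinder)).
  exact: sigma_cylinder.
move=> _ [_ [s _ <-] <-]; rewrite setTI flip_cylinder; exact: borel_cylinder.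
Qed.

HB.instance Definition _ k := isMeasurableFun.Build _ _ _ _ (flip k) (measurable_flip k).

(** Flipping a bit sends each cylinder to one of the same length, hence of the same measure. *)
Lemma coin_flip k A : borel A -> coin (flip k @^-1` A) = coin A.
Proof.
move=> bA; apply: (@borel_measure_unique (distribution coin (flip k)) coin) => //.
  have e : distribution coin (flip k) setT = 1%E by exact: probability_setT.
  by rewrite [X in (X < _)%E]e ltry.
move=> s; rewrite -[LHS]/(coin (flip k @^-1` cylinder s)) flip_cylinder.
by rewrite -[RHS]/(coin (cylinder s)) !coin_cylinder size_mkseq.
Qed.

Lemma E0_flip k a : E0 a (flip k a).
Proof.
apply: (@sub_finite_set _ _ [set k]); last exact: finite_set1.
move=> n /= h; apply: contrapT => /eqP nk; apply: h.
by rewrite /flip (negbTE nk).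
Qed.

Lemma borelI (T : topologicalType) (A B : set T) : borel A -> borel B -> borel (A `&` B).
Proof.
move=> bA bB; rewrite -[A `&` B]setCK setCI; apply: borelC.
by apply: borelU; exact: borelC.
Qed.

Lemma cylinder_rcons s c : cylinder (rcons s c) = cylinder s `&` [set a | a (size s) = c].
Proof.
apply/seteqP; split=> a.
  move=> h; split=> [i is_|/=].
    by rewrite h ?size_rcons ?nth_rcons ?is_// ltnS ltnW.
  by rewrite h ?size_rcons ?ltnS// nth_rcons ltnn eqxx.
move=> [h /= as_] i; rewrite size_rcons ltnS nth_rcons leq_eqVlt => /orP[/eqP ->|is_].
  by rewrite ltnn eqxx.
by rewrite is_ h.
Qed.

Definition E0_invariant (A : set cantor_space) := forall x y, E0 x y -> A x -> A y.

Lemma coin_fin_num (A : set cantor_borel) : borel A -> coin A \is a fin_num.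
Proof. by move=> bA; apply: fin_num_measure. Qed.

(* Flipping the last bit of a cylinder shows that each half of it contains half
   of an invariant set. *)
Lemma coin_invariant_cylinder A s : borel A -> E0_invariant A ->
  fine (coin (A `&` cylinder s)) = 2^-1 ^+ size s * fine (coin A).
Proof.
move=> bA iA; elim/last_ind: s => [|s c IH].
  by rewrite cylinder_nil setIT expr0 mul1r.
have bAs t : borel (A `&` cylinder t) by apply: borelI => //; exact: borel_cylinder.
have e : coin (A `&` cylinder (rcons s (~~ c))) = coin (A `&` cylinder (rcons s c)).
  rewrite -(coin_flip (size s) (bAs (rcons s c))); congr coin.
  apply/seteqP; split=> a [Aa sa]; split.
  - exact: iA (@E0_flip _ _) Aa.
  - move: sa; rewrite !cylinder_rcons => -[sa /= as_]; split=> /=.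
      by move=> i is_; rewrite /flip sa// (ltn_eqF is_).
    by rewrite /flip eqxx as_ /= negbK.
  - by rewrite -(flipK (size s) a); exact: iA (@E0_flip _ _) Aa.
  - move: sa; rewrite /preimage /= !cylinder_rcons => -[sa /= as_]; split=> /=.
      by move=> i is_; rewrite -sa// /flip (ltn_eqF is_).
    by rewrite -as_ /flip eqxx negbK.
have U : A `&` cylinder s = (A `&` cylinder (rcons s c)) `|` (A `&` cylinder (rcons s (~~ c))).
  rewrite -setIUr; congr (_ `&` _); rewrite !cylinder_rcons -setIUr.
  rewrite (_ : _ `|` _ = setT) ?setIT//; apply/seteqP; split=> // a _ /=.
  by case: (a _); case: c {e}; [left|right|right|left].
have D : (A `&` cylinder (rcons s c)) `&` (A `&` cylinder (rcons s (~~ c))) = set0.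
  apply/seteqP; split=> // a [[_ +] [_ +]]; rewrite !cylinder_rcons => -[_ /= ->] [_ /=].
  by case: c {e U}.
have : fine (coin (A `&` cylinder s)) = fine (coin (A `&` cylinder (rcons s c))) *+ 2.
  rewrite U measureU //; [|exact: bAs|exact: bAs].
  rewrite -[LHS]/(fine (coin (A `&` cylinder (rcons s c)) +
    coin (A `&` cylinder (rcons s (~~ c))))%E).
  by rewrite e fineD ?coin_fin_num// -mulr2n.
rewrite IH size_rcons exprS => h.
rewrite -mulrA h; lra.
Qed.

(** An invariant [A] is independent of every cylinder, hence by uniqueness of measures of every
    Borel set, in particular of itself: its measure equals its own square. *)
Lemma coin_ergodic : ergodic E0 coin.
Proof.
move=> A bA iA.
have fA := coin_fin_num bA.
have p0 : (0 <= fine (coin A)) by rewrite fine_ge0.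
have e : coin (A `&` A) = (fine (coin A) * fine (coin A))%:E.
  transitivity (mscale (NngNum p0) coin A); last first.
    by rewrite /mscale /= -[X in (_ * X)%E](fineK fA) -EFinM.
  rewrite -[LHS]/(mrestr coin (bA : measurable (A : set cantor_borel)) A).
  apply: borel_measure_unique => //.
    by rewrite -[X in (X < _)%E]/(coin (setT `&` A)) setTI ltey_eq fA.
  move=> s; rewrite -[LHS]/(coin (cylinder s `&` A)).
  rewrite -[RHS]/((fine (coin A))%:E * coin (cylinder s))%E.
  have bs : borel (A `&` cylinder s) by apply: borelI => //; exact: borel_cylinder.
  rewrite setIC -(fineK (coin_fin_num bs)) coin_invariant_cylinder//.
  by rewrite coin_cylinder -EFinM mulrC.
move: e; rewrite setIid -{1}(fineK fA) => -[/eqP].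
rewrite -subr_eq0 -{1}[fine _]mulr1 -mulrBr mulf_eq0 subr_eq0 => /orP[/eqP h|/eqP h].
  by left; exact: etrans (esym (fineK fA)) (congr1 EFin h).
by right; exact: etrans (esym (fineK fA)) (congr1 EFin (esym h)).
Qed.

Lemma coin_set1 (a : cantor_space) : coin [set a] = 0%E.
Proof.
have ba : borel [set a].
  by apply: borel_closed; exact/accessible_closed_set1/hausdorff_accessible/cantor_space_hausdorff.
have le n : fine (coin [set a]) <= 2^-1 ^+ n.
  have -> : 2^-1 ^+ n = fine (coin (cylinder (mkseq a n))).
    by rewrite coin_cylinder size_mkseq.
  apply: fine_le; rewrite ?coin_fin_num//; first exact: borel_cylinder.
  apply: le_measure; rewrite ?inE//; first exact: borel_cylinder.
  by move=> _ ->; rewrite /cylinder /= size_mkseq; exact: agree_sym (agree_sym (@agree_mkseq n a)).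
apply/eqP; rewrite eq_le measure_ge0 andbT -(fineK (coin_fin_num ba)) lee_fin.
apply/ler_addgt0Pl => eps eps0; rewrite addr0.
have /cvgrPdist_lt/(_ _ eps0)[N _ hN] : (2^-1 : R) ^+ n @[n --> \oo] --> 0.
  by apply: cvg_expr; rewrite ger0_norm ?invr_ge0// invf_lt1 ?ltr1n.
have := hN N (leqnn N); rewrite /= sub0r normrN ger0_norm ?exprn_ge0 ?invr_ge0//.
by move=> /ltW; exact: le_trans.
Qed.

Definition E0_translates (x : cantor_space) (n : nat) : set cantor_space :=
  if unpickle n is Some s then [set (fun i => nth false s i (+) x i)] else set0.

Lemma E0_classE x : [set y | E0 x y] = \bigcup_n E0_translates x n.
Proof.
apply/seteqP; split=> y.
  move=> /E0_bound[n hn].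
  exists (pickle (mkseq (fun i => x i (+) y i) n)) => //; rewrite /E0_translates pickleK /=.
  apply/funext => i; have [ni|i_n] := leqP n i.
    by rewrite nth_default ?size_mkseq//= hn.
  by rewrite nth_mkseq// addbC addbA addbb.
move=> [n _]; rewrite /E0_translates; case: unpickle => [s /= ->|//].
apply: (@sub_finite_set _ _ `I_(size s)); last exact: finite_II.
move=> i /= h; rewrite ltnNge; apply/negP => si; apply: h.
by rewrite nth_default.
Qed.

Lemma coin_nonatomic : nonatomic E0 coin.
Proof.
move=> x; rewrite E0_classE.
suff h n : coin.-negligible (E0_translates x n : set cantor_borel) by exact: negligible_bigcup.
rewrite /E0_translates; case: unpickle => [s|]; last exact: negligible_set0.
apply/negligibleP; last exact: coin_set1.
by apply: borel_closed; exact/accessible_closed_set1/hausdorff_accessible/cantor_space_hausdorff.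
Qed.

End coin.

(** * The dichotomy *)

Lemma borel_fun_preimage (S T : topologicalType) (f : S -> T) :
  (forall U, open U -> borel (f @^-1` U)) -> borel_fun f.
Proof. by move=> h B; apply: (borel_preimage (G := open)). Qed.

Lemma continuous_borel_fun (S T : topologicalType) (f : S -> T) :
  continuous f -> borel_fun f.
Proof.
by move=> /continuousP cf; apply: borel_fun_preimage => U oU; apply: borel_open; exact: cf.
Qed.

Lemma fin_seq0 : fin_seq (fun=> false).
Proof. by rewrite /fin_seq /= (_ : mkset _ = set0)//; apply/seteqP; split. Qed.

Lemma E0_idn_continuous : continuous E0_idn.
Proof.
pose g0 : discrete_topology fin_seq := exist _ (fun=> false) (mem_set fin_seq0).
have -> : E0_idn = E0_chart \o (fun x => (g0, x)).
  by apply/funext => x; apply: E0_arrow_eq => //=; apply/funext => n.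
have [_ cc _] := E0_chart_homeomorphism.
have cp : continuous (fun x : cantor_space => (g0, x)).
  move=> x U [[A B] [/= nA nB] AB]; apply: filterS nB => y By; apply: AB.
  by split=> //; exact: nbhs_singleton.
by move=> x; apply: continuous_comp; [exact: cp|exact: cc].
Qed.

Section embeds.
Variables (R : realType) (Obj Arr : topologicalType) (G : groupoid Obj Arr).
Hypothesis polishG : polish_groupoid R G.
Variables (F0 : cantor_space -> Obj) (F1 : E0_arrow -> Arr).
Hypotheses (F1_functor : is_functor E0_groupoid G F0 F1) (F1_inj : injective F1)
  (F1_cont : continuous F1).
Hypothesis F0_equiv : forall x y, E0 x y <-> orbit_equiv G (F0 x) (F0 y).

Lemma functor_obj_continuous : continuous F0.
Proof.
have [sF _ _ _] := F1_functor.
have -> : F0 = src G \o F1 \o E0_idn by apply/funext => x; rewrite /= sF.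
move=> x; apply: continuous_comp; first exact: E0_idn_continuous.
by apply: continuous_comp; [exact: F1_cont|exact: (src_continuous polishG)].
Qed.

Lemma functor_obj_inj : injective F0.
Proof.
have [_ _ iF _] := F1_functor.
move=> x y e; have := congr1 (idn G) e; rewrite -!iF => /F1_inj.
by move/(congr1 E0_src).
Qed.

Lemma functor_obj_borel : borel_fun F0.
Proof. by apply: continuous_borel_fun; exact: functor_obj_continuous. Qed.

(** Nonatomicity requires Borel null sets containing the orbits. The range of [F0] is compact, so
    its complement is Borel and null; an orbit meets the range in at most the image of one E0-class,
    a countable set of null points. *)
Lemma E0_embeds_nonatomic_ergodic : exists (x0 : Obj) (mu : probability (borel_space x0) R),
  nonatomic (orbit_equiv G) mu /\ ergodic (orbit_equiv G) mu.
Proof.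
pose x0 := F0 (fun=> false).
pose c0 := ((fun=> false) : cantor_space).
have mF : measurable_fun (setT : set (borel_space c0)) (F0 : borel_space c0 -> borel_space x0).
  by move=> _ B bB; rewrite setTI; exact: functor_obj_borel.
pose X : {mfun borel_space c0 >-> borel_space x0} :=
  HB.pack (F0 : borel_space c0 -> borel_space x0) (isMeasurableFun.Build _ _ _ _ _ mF).
pose mu : probability (borel_space x0) R := distribution (coin R) X.
have muE (A : set (borel_space x0)) : mu A = coin R (F0 @^-1` A) by [].
have hO := polish_hausdorff (pg_polish_objects polishG).
have borel1 (y : Obj) : borel [set y].
  by apply: borel_closed; exact/accessible_closed_set1/hausdorff_accessible.
exists x0, mu; split.
- move=> x.
  have negC : mu.-negligible (~` range F0 : set (borel_space x0)).
    exists (~` range F0); split=> //.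
      apply: (@borelC Obj); apply: borel_closed; apply: compact_closed => //.
      apply: continuous_compact; last exact: cantor_space_compact.
      by apply: continuous_subspaceT; exact: functor_obj_continuous.
    rewrite muE (_ : _ @^-1` _ = set0) ?measure0//.
    by apply/seteqP; split=> // a; case; exists a.
  have [[a xa]|na] := pselect (exists a, orbit_equiv G x (F0 a)); last first.
    apply: negligibleS negC => y xy [a _ ay]; apply: na; exists a.
    by rewrite ay.
  have negO : mu.-negligible (F0 @` [set a' | E0 a a'] : set (borel_space x0)).
    rewrite E0_classE image_bigcup.
    suff h n : mu.-negligible (F0 @` E0_translates a n : set (borel_space x0)).
      exact: negligible_bigcup.
    rewrite /E0_translates; case: unpickle => [s|]; last first.
      by rewrite image_set0; exact: negligible_set0.
    rewrite image_set1; set a' : cantor_space := fun i => _.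
    exists [set F0 a']; split=> //; first exact: borel1.
    rewrite muE (_ : _ @^-1` _ = [set a']); first exact: coin_set1.
    by apply/seteqP; split=> z /= => [/functor_obj_inj|->].
  apply: negligibleS (negligibleU negC negO) => y xy.
  have [[a' _ ay]|ny] := pselect (range F0 y); last by left.
  right; exists a' => //=; apply/F0_equiv; rewrite ay.
  exact: orbit_equiv_trans (orbit_equiv_sym xa) xy.
- move=> A bA iA; rewrite muE; apply: (@coin_ergodic R).
    exact: functor_obj_borel.
  by move=> a a' /F0_equiv; exact: iA.
Qed.

End embeds.

Lemma E0_embeds_borel_reducible (R : realType) (Obj Arr : topologicalType)
    (G : groupoid Obj Arr) :
  polish_groupoid R G -> E0_embeds G -> borel_reducible E0 (orbit_equiv G).
Proof.
move=> pG [F0 [F1 [functor F1i F1c F0E]]]; exists F0.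
  exact: (functor_obj_borel pG functor F1c).
exact: F0E.
Qed.

Lemma borel_reducible_smooth (R : realType) (S T : topologicalType)
    (E : S -> S -> Prop) (F : T -> T -> Prop) :
  borel_reducible E F -> smooth R F -> smooth R E.
Proof.
move=> [f bf fE] [Y pY [g bg gE]]; exists Y => //; exists (g \o f).
  by move=> B bB; exact: (bf _ (bg _ bB)).
by move=> x y; rewrite fE gE.
Qed.

Theorem theorem3p17 (R : realType) (Obj Arr : topologicalType)
    (G : groupoid Obj Arr) (polishG : polish_groupoid R G)
    (Gdelta_Fsigma : forall x : Obj,
      Gdelta (orbit_of G x) -> Fsigma (orbit_of G x)) :
  [<-> exists x : Obj, ~ Gdelta (orbit_of G x);
       E0_embeds G;
       borel_reducible E0 (orbit_equiv G);
       exists (x0 : Obj) (mu : probability (borel_space x0) R),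
         nonatomic (orbit_equiv G) mu /\ ergodic (orbit_equiv G) mu;
       ~ smooth R (orbit_equiv G);
       ~ Gdelta [set p : Obj * Obj | orbit_equiv G p.1 p.2]%classic;
       exists x : Obj, ~ open_in_closure (orbit_of G x)].
Proof.
have [b bP] := polish_basis (pg_polish_objects polishG).
have nonGdelta : ~ smooth R (orbit_equiv G) -> exists x : Obj, ~ Gdelta (orbit_of G x).
  move=> ns; apply/existsNP => GO; apply: ns.
  exact: Gdelta_orbits_smooth polishG _ bP GO.
have embeds : (exists x : Obj, ~ Gdelta (orbit_of G x)) -> E0_embeds G.
  by move=> [x]; exact: (nonGdelta_orbit_E0_embeds polishG Gdelta_Fsigma).
tfae.
- exact: embeds.
- exact: (E0_embeds_borel_reducible polishG).
(* The reduction only serves to refute smoothness, which would pass to [E0] and contradict the coin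
   measure. This yields an orbit that is not Gdelta, hence an embedding, and the measure is
   transported along the latter. *)
- move=> red; have [F0 [F1 [functor F1i F1c F0E]]] : E0_embeds G.
    apply/embeds/nonGdelta => /(borel_reducible_smooth red).
    exact: nonatomic_ergodic_not_smooth (@coin_nonatomic R) (@coin_ergodic R).
  exact: (E0_embeds_nonatomic_ergodic polishG functor F1i F1c F0E).
- by move=> [x0 [mu [na erg]]]; exact: nonatomic_ergodic_not_smooth na erg.
- move=> ns GE; have [x nG] := nonGdelta ns.
  by apply: nG; exact: Gdelta_equiv_Gdelta_orbit GE.
- move=> nGE; apply/existsNP => oc; apply: nGE.
  apply: (Gdelta_orbits_Gdelta polishG bP) => x.
  exact: (open_in_closure_Gdelta polishG (oc x)).
- move=> [x nx]; exists x => gx; apply: nx.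
  exact: (Gdelta_orbit_open_in_closure polishG gx (Gdelta_Fsigma x gx)).
Qed.
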